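(* Let $n\ge 2$ be an integer, let $s\in(0,1)\setminus\{\tfrac12\}$, and let $f\in\mathcal{S}(\mathbb{R}^n;S^2(\mathbb{R}^n))$. Let $U\subset\mathbb{R}^n$ be any non-empty open set. If $f|_U=0$ and there exists a measurable set $E\subset U$ of positive measure such that $\mathcal{A}^0_{2,s}f=\mathcal{A}^1_{2,s}f=\mathcal{A}^2_{2,s}f=0$ in $E$, then $f\equiv 0$ in $\mathbb{R}^n$.
   Context: $\mathcal{S}(\mathbb{R}^n;S^2(\mathbb{R}^n))$ is the space of symmetric $2$-tensor fields $f=(f_{ij})$ on $\mathbb{R}^n$ with complex-valued Schwartz components. Repeated indices are summed from $1$ to $n$. The fractional divergent beam ray transform of $f$ is $(\chi_{s,2}f)(x,\xi)=\int_0^\infty t^{2s-1}f_{j_1j_2}(x+t\xi)\xi^{j_1}\xi^{j_2}\,dt$ for $x\in\mathbb{R}^n$, $\xi\in\mathbb{S}^{n-1}$. Its averages are $$\mathcal{A}^0_{2,s}f(x)=c^{2,0}_{n,s}\int_{\mathbb{S}^{n-1}}(\chi_{s,2}f)(x,\xi)\,dS_\xi,\quad \mathcal{A}^{1,i}_{2,s}f(x)=c^{2,1}_{n,s}\int_{\mathbb{S}^{n-1}}\xi^i(\chi_{s,2}f)(x,\xi)\,dS_\xi,$$ $$\mathcal{A}^{2,i_1,i_2}_{2,s}f(x)=c^{2,2}_{n,s}\int_{\mathbb{S}^{n-1}}\xi^{i_1}\xi^{i_2}(\chi_{s,2}f)(x,\xi)\,dS_\xi,$$ and $\mathcal{A}^1_{2,s}f=(\mathcal{A}^{1,i}_{2,s}f)_{i=1}^n$,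 $\mathcal{A}^2_{2,s}f=(\mathcal{A}^{2,i_1,i_2}_{2,s}f)_{i_1,i_2=1}^n$, with the nonzero constants $$c^{2,0}_{n,s}=\frac{-\Gamma\left(\frac{n+2-2s}{2}\right)}{2^{2s-1}\pi^{n/2}\Gamma(s)},\quad c^{2,1}_{n,s}=\frac{-\Gamma\left(\frac{n+3-2s}{2}\right)}{2^{2s-1}\pi^{n/2}\Gamma\left(s+\frac12\right)},\quad c^{2,2}_{n,s}=\frac{-\Gamma\left(\frac{n+4-2s}{2}\right)}{2^{2s-2}\pi^{n/2}\Gamma(s)}.$$ *)

(* Defs.v *)
From HB Require Import structures.
From mathcomp Require Import all_boot all_order all_algebra.
From mathcomp Require Import all_classical all_reals all_analysis.
From mathcomp Require Import measurable_realfun complex.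

Set Implicit Arguments.
Unset Strict Implicit.
Unset Printing Implicit Defensive.

Import Order.TTheory GRing.Theory Num.Theory.
Import numFieldNormedType.Exports.

Local Open Scope classical_set_scope.
Local Open Scope complex_scope.
Local Open Scope ring_scope.

(* Row vectors carry the product sigma-algebra, generated by the coordinate
   maps; over R this is the Borel sigma-algebra of R^n. *)
Section measurable_row_vector.
Context {R : realType} (n : nat).

Let coord (i : 'I_n) (x : 'rV[R]_n) : R := x 0 i.

Let rV_set0 : g_sigma_preimage coord set0.
Proof. exact: sigma_algebra0. Qed.

Let rV_setC A : g_sigma_preimage coord A -> g_sigma_preimage coord (~` A).
Proof. exact: sigma_algebraC. Qed.

Let rV_bigcup (F : (set _)^nat) : (forall i, g_sigma_preimage coord (F i)) ->
  g_sigma_preimage coord (\bigcup_i (F i)).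
Proof. exact: sigma_algebra_bigcup. Qed.

HB.instance Definition _ :=
  @isMeasurable.Build default_measure_display
    'rV[R]_n (g_sigma_preimage coord) rV_set0 rV_setC rV_bigcup.

Lemma measurable_coord (i : 'I_n) :
  measurable_fun [set: 'rV[R]_n] (fun x : 'rV[R]_n => x 0 i).
Proof.
move=> _ Y mY; rewrite setTI; apply: sub_sigma_algebra => /=.
rewrite -bigcup_seq/=; exists i => /=; first by rewrite mem_index_enum.
by exists Y => //; rewrite setTI.
Qed.

Lemma measurable_rVP d (T : measurableType d) (f : T -> 'rV[R]_n) :
  (forall i, measurable_fun [set: T] (fun t => f t 0 i)) ->
  measurable_fun [set: T] f.
Proof.
move=> mf.
suff H : g_sigma_preimage (fun i => coord i \o f) `<=` measurable.
  by move=> _ A mA; apply: H; rewrite g_sigma_preimage_comp; exists A.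
apply: smallest_sub; first exact: sigma_algebra_measurable.
move=> A; rewrite -bigcup_seq => -[i _ [B mB <-]].
exact: mf.
Qed.

End measurable_row_vector.

Definition rV_cons {R : realType} n (p : R * 'rV[R]_n) : 'rV[R]_n.+1 :=
  \row_i (if unlift ord0 i is Some j then p.2 0 j else p.1).

Definition rV_uncons {R : realType} n (x : 'rV[R]_n.+1) : R * 'rV[R]_n :=
  (x 0 ord0, \row_j x 0 (lift ord0 j)).

Section lebesgue_step.
Context {R : realType} (n : nat).

Lemma rV_consK : cancel (@rV_cons R n) (@rV_uncons R n).
Proof.
move=> [t y]; rewrite /rV_cons /rV_uncons mxE unlift_none; congr pair.
by apply/rowP => j; rewrite !mxE liftK.
Qed.

Lemma measurable_rV_cons : measurable_fun [set: R * 'rV[R]_n] (@rV_cons R n).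
Proof.
apply: measurable_rVP => i; under eq_fun do rewrite mxE.
case: unliftP => [j _|_]; last exact: measurable_fst.
by apply: (measurableT_comp (measurable_coord j)); exact: measurable_snd.
Qed.

Lemma measurable_rV_uncons : measurable_fun [set: 'rV[R]_n.+1] (@rV_uncons R n).
Proof.
apply/measurable_fun_pairP; split; first exact: (measurable_coord ord0).
apply: measurable_rVP => i /=; under eq_fun do rewrite mxE.
exact: measurable_coord.
Qed.

Variable mu : {sigma_finite_measure set 'rV[R]_n -> \bar R}.

Definition lebesgue_cons : set 'rV[R]_n.+1 -> \bar R :=
  pushforward (@lebesgue_measure R \x mu)%E (@rV_cons R n).

Let cons0 : lebesgue_cons set0 = 0%E.
Proof. by rewrite /lebesgue_cons /pushforward preimage_set0 measure0. Qed.

Let cons_ge0 A : (0 <= lebesgue_cons A)%E.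
Proof. by rewrite /lebesgue_cons /pushforward measure_ge0. Qed.

Let cons_sigma_additive : semi_sigma_additive lebesgue_cons.
Proof.
move=> F mF tF mUF; rewrite /lebesgue_cons /pushforward preimage_bigcup.
apply: measure_semi_sigma_additive.
- by move=> k; rewrite -[X in measurable X]setTI; exact: measurable_rV_cons.
- apply/trivIsetP => /= i j _ _ ij; rewrite -preimage_setI.
  by move/trivIsetP : tF => /(_ _ _ _ _ ij) ->//; rewrite preimage_set0.
- rewrite -preimage_bigcup -[X in measurable X]setTI.
  exact: measurable_rV_cons.
Qed.

HB.instance Definition _ := isMeasure.Build _ _ _ lebesgue_cons
  cons0 cons_ge0 cons_sigma_additive.

Let cons_sigma_finite : sigma_finite setT lebesgue_cons.
Proof.
have /sigma_finiteP[F [FT ndF Foo]] := sigma_finiteT (@lebesgue_measure R).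
have /sigma_finiteP[G [GT ndG Goo]] := sigma_finiteT mu.
exists (fun k => @rV_uncons R n @^-1` (F k `*` G k)).
  rewrite -preimage_bigcup -[LHS](preimage_setT (@rV_uncons R n)).
  congr preimage; apply/esym; rewrite -subTset => -[t y] _.
  have [i _ Fit] : (\bigcup_i F i) t by rewrite -FT.
  have [j _ Gjy] : (\bigcup_i G i) y by rewrite -GT.
  exists (maxn i j) => //; split => /=.
  - by move: t Fit; exact/subsetPset/ndF/leq_maxl.
  - by move: y Gjy; exact/subsetPset/ndG/leq_maxr.
move=> k; have [mF Fk] := Foo k; have [mG Gk] := Goo k; split.
  rewrite -[X in measurable X]setTI; apply: measurable_rV_uncons => //.
  exact: measurableX.
rewrite /lebesgue_cons /pushforward -comp_preimage.
rewrite (_ : _ \o _ = id) ?preimage_id; last first.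
  by apply/funext => p; exact: rV_consK.
by rewrite product_measure1E// lte_mul_pinfty// ge0_fin_numE.
Qed.

HB.instance Definition _ := Measure_isSigmaFinite.Build _ _ _ lebesgue_cons
  cons_sigma_finite.

End lebesgue_step.

Fixpoint lebesgue_rV {R : realType} n :
    {sigma_finite_measure set 'rV[R]_n -> \bar R} :=
  match n with
  | 0 => \d_(0 : 'rV[R]_0)
  | m.+1 => lebesgue_cons (lebesgue_rV m)
  end.

Section lebesgue_measurable_sets.
Context {R : realType} (n : nat).
Local Open Scope measure_scope.

(* The outer measure induced by Lebesgue measure; its Caratheodory-measurable
   sets are the Lebesgue measurable subsets of R^n. *)
Definition lebesgue_outer : set 'rV[R]_n -> \bar R := (lebesgue_rV n)^*.

Definition lebesgue_measurable (E : set 'rV[R]_n) : Prop :=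
  lebesgue_outer.-cara.-measurable E.

End lebesgue_measurable_sets.

(* The library norm on row vectors is the sup norm. *)
Definition enorm {R : realType} n (x : 'rV[R]_n) : R :=
  Num.sqrt (\sum_i x 0 i ^+ 2).

Definition unit_sphere {R : realType} n : set 'rV[R]_n := [set x | enorm x = 1].

Definition punctured_ball {R : realType} n : set 'rV[R]_n :=
  [set x | 0 < enorm x <= 1].

Definition normalize {R : realType} n (x : 'rV[R]_n) : 'rV[R]_n :=
  (enorm x)^-1 *: x.

Section surface_measure.
Context {R : realType} (n : nat).

Lemma enorm_ge0 (x : 'rV[R]_n) : 0 <= enorm x. Proof. exact: sqrtr_ge0. Qed.

Lemma measurable_enorm : measurable_fun [set: 'rV[R]_n] (@enorm R n).
Proof.
rewrite (_ : @enorm R n = fun x => (\sum_i x 0 i ^+ 2) `^ 2^-1); last first.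
  apply/funext => x; rewrite powR12_sqrt// sumr_ge0// => i _.
  by rewrite sqr_ge0.
apply: (measurableT_comp (measurable_powR 2^-1)).
apply: measurable_sum => i; apply: measurable_funX; exact: measurable_coord.
Qed.

Lemma measurable_normalize : measurable_fun [set: 'rV[R]_n] (@normalize R n).
Proof.
apply: measurable_rVP => i.
rewrite (_ : (fun _ => _) = fun x => enorm x `^ (- 1) * x 0 i); last first.
  by apply/funext => x; rewrite mxE powR_inv1// enorm_ge0.
apply: measurable_funM; last exact: measurable_coord.
exact: (measurableT_comp (measurable_powR (- 1)) measurable_enorm).
Qed.

Lemma measurable_punctured_ball : measurable (@punctured_ball R n).
Proof.
rewrite (_ : @punctured_ball R n = @enorm R n @^-1` `]0, 1]%classic); last first.
  by apply/seteqP; split => x /=; rewrite in_itv.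
rewrite -[X in measurable X]setTI.
by apply: measurable_enorm => //; exact: measurable_itv.
Qed.

(* Surface measure of the unit sphere: sigma(A) is n times the volume of the
   cone { r xi : xi in A, 0 < r <= 1 }. *)
Definition surface_measure (A : set 'rV[R]_n) : \bar R :=
  (n%:R%:E * lebesgue_rV n (@punctured_ball R n `&` @normalize R n @^-1` A))%E.

Let surface_measure0 : surface_measure set0 = 0%E.
Proof. by rewrite /surface_measure preimage_set0 setI0 measure0 mule0. Qed.

Let surface_measure_ge0 A : (0 <= surface_measure A)%E.
Proof. by rewrite /surface_measure mule_ge0// lee_fin. Qed.

Let surface_measure_sigma_additive : semi_sigma_additive surface_measure.
Proof.
move=> F mF tF mUF; rewrite [X in X @ \oo --> _](_ : _ = (fun k => n%:R%:E *
  \sum_(0 <= i < k) lebesgue_rV n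
    (@punctured_ball R n `&` @normalize R n @^-1` F i))%E); last first.
  by apply/funext => k; rewrite ge0_sume_distrr.
apply: cvgeZl => //; rewrite preimage_bigcup setI_bigcupr.
have mI i : measurable (@punctured_ball R n `&` @normalize R n @^-1` F i).
  apply: measurableI; first exact: measurable_punctured_ball.
  by rewrite -[X in measurable X]setTI; exact: measurable_normalize.
apply: measure_semi_sigma_additive => //.
- apply/trivIsetP => /= i j _ _ ij; rewrite setIACA -preimage_setI.
  by move/trivIsetP : tF => /(_ _ _ _ _ ij) ->//; rewrite preimage_set0 setI0.
- exact: bigcupT_measurable.
Qed.

HB.instance Definition _ := isMeasure.Build _ _ _ surface_measure
  surface_measure0 surface_measure_ge0 surface_measure_sigma_additive.

End surface_measure.

Definition cintegral d (T : measurableType d) (R : realType)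
    (mu : {measure set T -> \bar R}) (D : set T) (g : T -> R[i]) : R[i] :=
  (\int[mu]_(x in D) complex.Re (g x)) +i* (\int[mu]_(x in D) complex.Im (g x)).

Section schwartz.
Context {R : realType} (n : nat).

Definition partial (i : 'I_n) (g : 'rV[R]_n -> R) : 'rV[R]_n -> R :=
  fun x => 'D_(delta_mx 0 i) g x.

Definition partials (l : seq 'I_n) (g : 'rV[R]_n -> R) : 'rV[R]_n -> R :=
  foldr partial g l.

(* C^infinity: partial derivatives of all orders exist and are continuous. *)
Definition smooth (g : 'rV[R]_n -> R) : Prop :=
  forall l : seq 'I_n, continuous (partials l g) /\
    forall (i : 'I_n) (x : 'rV[R]_n), derivable (partials l g) x (delta_mx 0 i).

Definition schwartz (g : 'rV[R]_n -> R) : Prop :=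
  smooth g /\
  forall (l : seq 'I_n) (b : 'I_n -> nat), exists M : R,
    forall x : 'rV[R]_n, `|(\prod_i x 0 i ^+ b i) * partials l g x| <= M.

Definition cschwartz (g : 'rV[R]_n -> R[i]) : Prop :=
  schwartz (fun x => complex.Re (g x)) /\ schwartz (fun x => complex.Im (g x)).

Definition schwartz_sym2 (f : 'rV[R]_n -> 'M[R[i]]_n) : Prop :=
  (forall x, (f x)^T = f x) /\ forall i j, cschwartz (fun x => f x i j).

End schwartz.

(* Euler's integral, which represents the Gamma function for a > 0 only. *)
Definition Gamma {R : realType} (a : R) : R :=
  \int[@lebesgue_measure R]_(t in `]0, +oo[) (t `^ (a - 1) * expR (- t)).

Section averages.
Context {R : realType} (n : nat).
Implicit Types (s : R) (f : 'rV[R]_n -> 'M[R[i]]_n) (x xi : 'rV[R]_n).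

Definition chi s f x xi : R[i] :=
  cintegral (@lebesgue_measure R) `]0, +oo[ (fun t : R =>
    (t `^ (2 * s - 1))%:C *
    \sum_j1 \sum_j2 f (x + t *: xi) j1 j2 * (xi 0 j1)%:C * (xi 0 j2)%:C).

Definition c20 s : R :=
  - Gamma ((n%:R + 2 - 2 * s) / 2) /
    (2 `^ (2 * s - 1) * pi `^ (n%:R / 2) * Gamma s).

Definition c21 s : R :=
  - Gamma ((n%:R + 3 - 2 * s) / 2) /
    (2 `^ (2 * s - 1) * pi `^ (n%:R / 2) * Gamma (s + 2^-1)).

Definition c22 s : R :=
  - Gamma ((n%:R + 4 - 2 * s) / 2) /
    (2 `^ (2 * s - 2) * pi `^ (n%:R / 2) * Gamma s).

Definition average0 s f x : R[i] :=
  (c20 s)%:C * cintegral (@surface_measure R n) (@unit_sphere R n)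
    (fun xi => chi s f x xi).

Definition average1 s f x (i : 'I_n) : R[i] :=
  (c21 s)%:C * cintegral (@surface_measure R n) (@unit_sphere R n)
    (fun xi => (xi 0 i)%:C * chi s f x xi).

Definition average2 s f x (i1 i2 : 'I_n) : R[i] :=
  (c22 s)%:C * cintegral (@surface_measure R n) (@unit_sphere R n)
    (fun xi => (xi 0 i1)%:C * (xi 0 i2)%:C * chi s f x xi).

End averages.

(* Main.v *)
(* In polar coordinates A^2 f is, up to a nonzero constant, the convolution of
   the components f_jk with y_j y_k y_l y_m |y|^(2s-n-4). On E it vanishes, and
   since f = 0 near E it is differentiable there. If a function u vanishes on E,
   then so do its partial derivatives, up to null sets: on a line parallel to a
   coordinate axis, the zeros of u at which the derivative is nonzero are
   isolated, hence countable. So all divergences of A^2 f vanish almost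
   everywhere on E, and combining them shows that, with c = 2s-n-2, the potential
   with kernel |y|^c of the trace of f and then, the trace being zero, those of
   the f_jk vanish almost everywhere on E (s <> 1/2 enters as c+n+1 <> 0).
   Let g be such a component. By differentiation there is a point x0 at which
   the integral of g(x0-y) p(y) |y|^(c-2k) is zero for all homogeneous p of
   degree k. After the inversion z = y/|y|^2 this is the integral of
   h(z) = g(x0-y) |y|^c against p(z), with z bounded on the support of g; testing
   with powers of a polynomial that peaks at a single point gives g = 0. *)

From HB Require Import structures.
Require Import Defs.
From mathcomp Require Import all_boot all_order all_algebra.
From mathcomp Require Import all_classical all_reals all_analysis.
From mathcomp Require Import measurable_realfun complex ring lra.
Import Order.TTheory GRing.Theory Num.Theory.
Import numFieldNormedType.Exports.

Set Implicit Arguments.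
Unset Strict Implicit.
Unset Printing Implicit Defensive.

Local Open Scope classical_set_scope.
Local Open Scope complex_scope.
Local Open Scope ring_scope.

(** * Lebesgue measure on row vectors *)

(** The kernels are singular at the origin. Among countably many rational boxes there is one, V,
    that meets E in a non-null set and whose 2r-neighbourhood lies in U, where [f] vanishes. On V
    every kernel can therefore be cut off below radius r without changing its potential; it is then
    bounded, and differentiation under the integral is legitimate. Kernels are indexed by a list of
    indices and a real exponent, so the argument becomes formal calculus with such pairs.
    Divergences follow Euler's rule: for K homogeneous of degree d, the divergence of y K(y) is (n +
    d) K. The first divergence of A^2 f has the factor c+n+1 = 2s-1, the next one c+n = 2s-2. A
    later divergence, needed for the components, contains the potential of the trace of [f] with
    kernel y_l y_m |y|^(c-2); this is why the trace has to be eliminated first. Real and imaginary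
    parts are treated separately. *)

Section affine_change.
Context {R : realType}.
Local Notation leb := (@lebesgue_measure R).

Lemma measurable_affine (r a : R) :
  measurable_fun [set: R] (fun t : R => r * t + a).
Proof. by apply: measurable_funD => //; exact: measurable_funM. Qed.

(** The image of Lebesgue measure under the map, multiplied by r, gives each half-open interval its
    length, and these values determine Lebesgue measure. *)
Lemma lebesgue_measure_affine (r a : R) (A : set R) : 0 < r -> measurable A ->
  leb ((fun t => r * t + a) @^-1` A) = (r^-1%:E * leb A)%E.
Proof.
move=> r0 mA; pose aff (t : R) := r * t + a.
have maff : measurable_fun [set: measurableTypeR R] (aff : _ -> measurableTypeR R).
  exact: measurable_affine.
pose phi : {mfun (measurableTypeR R) >-> (measurableTypeR R)} :=
  HB.pack aff (isMeasurableFun.Build _ _ _ _ _ maff).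
pose mu : {measure set (measurableTypeR R) -> \bar R} :=
  mscale (NngNum (ltW r0)) (pushforward leb phi).
rewrite [X in (_ * X)%E](@lebesgue_measure_unique _ (mu maff)) //.
  rewrite /mu /= /mscale /pushforward /= muleA -EFinM mulVf ?gt_eqF//.
  by rewrite mul1e.
move=> _ [[x y] /= _ <-]; rewrite /mu /= /mscale /pushforward /=.
transitivity (r%:E * leb `]((x - a) / r)%R, ((y - a) / r)%R]%classic)%E; last first.
  congr (_ * leb _)%E; apply/seteqP; split => t /=; rewrite !in_itv/= ltr_pdivrMr// ler_pdivlMr//;
    by rewrite ltrBlDr lerBrDr mulrC.
rewrite !lebesgue_measure_itv/= !lte_fin ltr_pM2r ?invr_gt0// ltrD2r.
case: ifPn => _; last by rewrite mule0.
rewrite -!EFinD -EFinM; congr EFin.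
by rewrite -mulrBl mulrCA mulfV ?gt_eqF// mulr1; ring.
Qed.

End affine_change.

Section lebesgue_rV_basics.
Context {R : realType}.
Local Notation leb := (@lebesgue_measure R).
Local Notation lam n := (@lebesgue_rV R n).

Lemma measurable_affine_rV n (r : R) (a : 'rV[R]_n) :
  measurable_fun [set: 'rV[R]_n] (fun y : 'rV[R]_n => r *: y + a).
Proof.
apply: measurable_rVP => i; under eq_fun do rewrite !mxE.
by apply: measurable_funD => //; apply: measurable_funM => //;
  exact: measurable_coord.
Qed.

Lemma measurable_preimage d1 d2 (T1 : measurableType d1) (T2 : measurableType d2)
  (f : T1 -> T2) (A : set T2) : measurable_fun setT f -> measurable A ->
  measurable (f @^-1` A).
Proof. by move=> mf mA; rewrite -[X in measurable X]setTI; exact: mf. Qed.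

Lemma lebesgue_rVS n (A : set 'rV[R]_n.+1) :
  lam n.+1 A = (\int[leb]_t lam n (fun y => A (rV_cons (t, y))))%E.
Proof.
rewrite /= /lebesgue_cons /pushforward /= /product_measure1 /=.
apply: eq_integral => t _ /=; rewrite /xsection/=; congr (lebesgue_rV n _).
by apply/seteqP; split => y /=; rewrite inE.
Qed.

Lemma rV_cons_affine n (r : R) (a : 'rV[R]_n.+1) t y :
  r *: rV_cons (t, y) + a =
  rV_cons (r * t + (rV_uncons a).1, r *: y + (rV_uncons a).2).
Proof.
apply/rowP => i; rewrite !mxE /=.
case: unliftP => [j ->|->] //=; by rewrite !mxE.
Qed.

Lemma measurable_rV_slice n (A : set 'rV[R]_n.+1) t : measurable A ->
  measurable (fun y => A (rV_cons (t, y))).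
Proof.
move=> mA; rewrite [X in measurable X](_ : _ = (fun y => rV_cons (t, y)) @^-1` A)//.
apply: measurable_preimage => //.
apply: (measurableT_comp (@measurable_rV_cons R n)).
exact: pair1_measurable.
Qed.

Lemma ge0_integral_affine (r a : R) (f : R -> \bar R) : 0 < r ->
  measurable_fun [set: R] f -> (forall t, 0 <= f t)%E ->
  (\int[leb]_t f (r * t + a)%R = r^-1%:E * \int[leb]_t f t)%E.
Proof.
move=> r0 mf f0.
rewrite -[RHS]ge0_integralZl_EFin ?invr_ge0 ?ltW//.
pose aff (t : R) := r * t + a.
have maff : measurable_fun [set: measurableTypeR R] (aff : _ -> measurableTypeR R).
  exact: measurable_affine.
have := @ge0_integral_pushforward _ _ (measurableTypeR R) (measurableTypeR R) R aff maff leb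
  setT f measurableT mf.
move=> /(_ (fun _ _ => f0 _)); rewrite preimage_setT => /= <-.
have r0' : 0 <= r^-1 by rewrite invr_ge0 ltW.
rewrite ge0_integralZl_EFin//.
have := @ge0_integral_mscale _ (measurableTypeR R) R leb _ measurableT (NngNum r0') f.
move=> /(_ mf (fun _ _ => f0 _)) /= <-.
apply: eq_measure_integral => A mA _.
exact: (lebesgue_measure_affine a r0 mA).
Qed.

(** By induction on the dimension: the slices contribute r^-n and the integral over coordinate 0 one
    more factor r^-1. *)
Lemma lebesgue_rV_affine n (r : R) (a : 'rV[R]_n) (A : set 'rV[R]_n) :
  0 < r -> measurable A ->
  lam n ((fun y => r *: y + a) @^-1` A) = ((r ^- n)%:E * lam n A)%E.
Proof.
move=> r0; elim: n a A => [|n IH] a A mA.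
  rewrite expr0 invr1 mul1e /=; congr dirac.
  apply/seteqP; split => y /=; by rewrite (thinmx0 (r *: y + a)) (thinmx0 y).
rewrite !lebesgue_rVS.
transitivity (\int[leb]_t ((r ^- n)%:E *
   lam n (fun y => A (rV_cons ((r * t + (rV_uncons a).1)%R, y)))))%E.
  apply: eq_integral => t _.
  rewrite -(IH (rV_uncons a).2) /=; last exact: measurable_rV_slice.
  congr (lebesgue_rV n _); apply/funext => y /=.
  by rewrite rV_cons_affine.
have ms : measurable_fun [set: R] (fun t => lam n (fun y => A (rV_cons (t, y)))).
  have mA' : measurable (@rV_cons R n @^-1` A).
    by apply: measurable_preimage => //; exact: measurable_rV_cons.
  have := measurable_fun_xsection (lam n) mA'.
  congr measurable_fun; apply/funext => t /=; congr (lebesgue_rV n _).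
  by apply/seteqP; split => y; rewrite /xsection/= inE.
rewrite ge0_integralZl_EFin//; last 2 first.
  by apply: (measurableT_comp (f := fun t => lam n (fun y => A (rV_cons (t, y)))) ms);
    exact: measurable_affine.
  by rewrite invr_ge0 exprn_ge0// ltW.
rewrite (ge0_integral_affine _ (f := fun t => lam n (fun y => A (rV_cons (t, y)))))//.
by rewrite muleA -EFinM exprS invfM mulrC.
Qed.

Lemma ge0_integral_rV_affine n (r : R) (a : 'rV[R]_n) (f : 'rV[R]_n -> \bar R) :
  0 < r -> measurable_fun setT f -> (forall y, 0 <= f y)%E ->
  (\int[lam n]_y f (r *: y + a)%R = (r ^- n)%:E * \int[lam n]_y f y)%E.
Proof.
move=> r0 mf f0.
have := @ge0_integral_pushforward _ _ _ _ R _ (measurable_affine_rV r a) (lam n) setT f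
  measurableT mf.
move=> /(_ (fun _ _ => f0 _)); rewrite preimage_setT => /= <-.
have r0' : 0 <= r ^- n by rewrite invr_ge0 exprn_ge0// ltW.
rewrite -(@ge0_integral_mscale _ _ R _ _ measurableT (NngNum r0') f)//.
apply: eq_measure_integral => [|? A mA _]; first exact: measurable_affine_rV.
by rewrite /= /pushforward lebesgue_rV_affine.
Qed.

Lemma ge0_integral_rVS n (f : 'rV[R]_n.+1 -> \bar R) :
  measurable_fun setT f -> (forall y, 0 <= f y)%E ->
  (\int[lam n.+1]_y f y = \int[leb]_t \int[lam n]_y f (rV_cons (t, y)))%E.
Proof.
move=> mf f0.
have -> : (\int[lam n.+1]_y f y =
  \int[pushforward (leb \x lam n)%E (@rV_cons R n)]_y f y)%E by [].
rewrite ge0_integral_pushforward//; last exact: measurable_rV_cons.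
rewrite preimage_setT fubini_tonelli1//; last by move=> ?; exact: f0.
by apply: measurableT_comp => //; exact: measurable_rV_cons.
Qed.

End lebesgue_rV_basics.

(** * Polar coordinates *)

Section enorm_theory.
Context {R : realType} (n : nat).
Implicit Types x y : 'rV[R]_n.

Lemma sqr_enorm x : enorm x ^+ 2 = \sum_i x 0 i ^+ 2.
Proof. by rewrite /enorm sqr_sqrtr// sumr_ge0// => i _; rewrite sqr_ge0. Qed.

Lemma enormZ (t : R) x : enorm (t *: x) = `|t| * enorm x.
Proof.
rewrite /enorm -sqrtr_sqr -sqrtrM ?sqr_ge0//; congr Num.sqrt.
by rewrite mulr_sumr; apply: eq_bigr => i _; rewrite mxE exprMn.
Qed.

Lemma enorm0_eq0 x : enorm x = 0 -> x = 0.
Proof.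
move=> x0; apply/rowP => i; rewrite mxE; apply/eqP; rewrite -sqrf_eq0.
have := sqr_enorm x; rewrite x0 expr0n/= => /esym/eqP.
rewrite psumr_eq0 => [/allP/(_ i)|j _]; last exact: sqr_ge0.
by rewrite mem_index_enum => /(_ isT).
Qed.

Lemma enorm0 : enorm (0 : 'rV[R]_n) = 0.
Proof. by rewrite -(scale0r 0) enormZ normr0 mul0r. Qed.

Lemma enorm_gt0 x : (0 < enorm x) = (x != 0).
Proof.
rewrite lt_def enorm_ge0 andbT; congr (~~ _); apply/eqP/eqP => [|->].
  exact: enorm0_eq0.
exact: enorm0.
Qed.

Lemma coord_le_enorm x i : `|x 0 i| <= enorm x.
Proof.
rewrite -ler_sqr ?nnegrE ?enorm_ge0// sqr_enorm real_normK ?num_real//.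
by rewrite (bigD1 i)//= lerDl sumr_ge0// => j _; rewrite sqr_ge0.
Qed.

Lemma enorm_le_sum x : enorm x <= \sum_i `|x 0 i|.
Proof.
have s0 : 0 <= \sum_i `|x 0 i| by apply: sumr_ge0.
rewrite -ler_sqr ?nnegrE ?enorm_ge0// sqr_enorm.
rewrite expr2 mulr_suml; apply: ler_sum => i _.
rewrite -real_normK ?num_real// expr2 ler_wpM2l//.
by rewrite (bigD1 i)//= lerDl sumr_ge0.
Qed.

Lemma cauchy_schwarz x y : \sum_i x 0 i * y 0 i <= enorm x * enorm y.
Proof.
have [->|x0] := eqVneq x 0.
  by rewrite enorm0 mul0r big1// => i _; rewrite mxE mul0r.
have [->|y0] := eqVneq y 0.
  by rewrite enorm0 mulr0 big1// => i _; rewrite mxE mulr0.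
have a0 : 0 < enorm x by rewrite enorm_gt0.
have b0 : 0 < enorm y by rewrite enorm_gt0.
set a := enorm x in a0 *; set b := enorm y in b0 *.
(* With a = |x| and b = |y| this sum equals 2ab(ab - x.y). *)
have : 0 <= \sum_i (b * x 0 i - a * y 0 i) ^+ 2.
  by apply: sumr_ge0 => i _; rewrite sqr_ge0.
have -> : \sum_i (b * x 0 i - a * y 0 i) ^+ 2 =
    b ^+ 2 * (\sum_i x 0 i ^+ 2) + a ^+ 2 * (\sum_i y 0 i ^+ 2)
    - 2 * a * b * (\sum_i x 0 i * y 0 i).
  by rewrite !mulr_sumr -sumrN -!big_split/=; apply: eq_bigr => i _; ring.
rewrite -!sqr_enorm -/a -/b => H.
have ab0 : 0 < a * b by rewrite mulr_gt0.
rewrite -(ler_pM2l ab0); move: H; set s := \sum_i _; nra.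
Qed.

Lemma ler_enormD x y : enorm (x + y) <= enorm x + enorm y.
Proof.
rewrite -ler_sqr ?nnegrE ?addr_ge0 ?enorm_ge0// sqr_enorm.
rewrite (eq_bigr (fun i => x 0 i ^+ 2 + y 0 i ^+ 2 + 2 * (x 0 i * y 0 i)));
  last by move=> i _; rewrite mxE; ring.
rewrite !big_split/= -!sqr_enorm -mulr_sumr.
by have := cauchy_schwarz x y; set s := \sum_i _; nra.
Qed.

Lemma enormN x : enorm (- x) = enorm x.
Proof. by rewrite -scaleN1r enormZ normrN1 mul1r. Qed.

Lemma enorm_delta i : enorm (delta_mx 0 i : 'rV[R]_n) = 1.
Proof.
rewrite -[RHS](@sqrtr1 R) /enorm; congr Num.sqrt.
rewrite (bigD1 i)//= big1 ?addr0 => [|j ji]; rewrite !mxE !eqxx /= ?expr1n//.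
by rewrite (negbTE ji) expr0n.
Qed.

End enorm_theory.

(** * Null sets by slicing, and coordinate boxes *)

Section null_and_positive_sets.
Context {R : realType}.
Local Notation leb := (@lebesgue_measure R).
Local Notation lam n := (@lebesgue_rV R n).

(** The recursive definition integrates over coordinate 0 last; here it is integrated first, which
    gives access to the lines parallel to axis 0. *)
Lemma lebesgue_rVS_swap n (A : set 'rV[R]_n.+1) : measurable A ->
  lam n.+1 A = (\int[lam n]_y leb (fun t => A (rV_cons (t, y))))%E.
Proof.
move=> mA.
have mA' : measurable (@rV_cons R n @^-1` A).
  by apply: measurable_preimage => //; exact: measurable_rV_cons.
transitivity ((leb \x^ lam n)%E (@rV_cons R n @^-1` A)).
  rewrite /= /lebesgue_cons /pushforward.
  by apply: product_measure_unique => //= *; rewrite product_measure2E.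
apply: eq_integral => y _ /=; rewrite /ysection/=; congr (lebesgue_measure _).
by apply/seteqP; split => t /=; rewrite inE.
Qed.

(** Slicing off coordinate 0 lowers both the dimension and [i], until the direction is axis 0; then
    the one-dimensional slices are countable, hence null. *)
Lemma null_of_countable_lines n (i : 'I_n) (Z : set 'rV[R]_n) : measurable Z ->
  (forall x, countable [set t : R | Z (x + t *: delta_mx 0 i)]) ->
  lam n Z = 0%E.
Proof.
elim: n i Z => [[]//|n IH] i Z mZ cZ.
case: (unliftP ord0 i) => [j ij|i0].
  rewrite lebesgue_rVS integral0_eq// => t _.
  apply: (IH j); first exact: measurable_rV_slice.
  move=> y; have := cZ (rV_cons (t, y)); congr countable.
  apply/funext => u /=; congr (Z _); apply/rowP => k; rewrite !mxE.
  case: unliftP => [l ->|->]; rewrite ?mxE ij /=.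
    by rewrite (inj_eq (@lift_inj _ ord0)).
  by rewrite mulr0 addr0.
rewrite lebesgue_rVS_swap// integral0_eq// => y _.
apply: countable_lebesgue_measure0.
have := cZ (rV_cons (0, y)); congr countable.
apply/funext => u /=; congr (Z _); apply/rowP => k; rewrite !mxE i0.
case: unliftP => [l ->|->] /=.
  by rewrite mulr0 addr0.
by rewrite mulr1 add0r.
Qed.

Definition box n (x : 'rV[R]_n) (r : R) : set 'rV[R]_n :=
  [set y | forall i, `|y 0 i - x 0 i| < r].

Lemma measurable_box n (x : 'rV[R]_n) r : measurable (box x r).
Proof.
rewrite (_ : box x r = \bigcap_(i in [set: 'I_n])
  ((fun y : 'rV[R]_n => y 0 i) @^-1` (ball (x 0 i) r))); last first.
  apply/seteqP; split => y /=; first by move=> h i _; rewrite /ball/= distrC.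
  by move=> h i; have := h i I; rewrite /ball/= distrC.
apply: fin_bigcap_measurable => // i _.
by apply: measurable_preimage; [exact: measurable_coord|exact: measurable_ball].
Qed.

Lemma box_gt0 n (x : 'rV[R]_n) r : 0 < r -> (0 < lam n (box x r))%E.
Proof.
move=> r0; elim: n x => [|n IH] x.
  rewrite /= diracE [_ \in _](_ : _ = true) ?lte01//.
  by apply/mem_set => -[].
rewrite /= /lebesgue_cons /pushforward.
rewrite (_ : _ @^-1` _ = ball (x 0 ord0) r `*` box (rV_uncons x).2 r).
  rewrite product_measure1E; [|exact: measurable_ball|exact: measurable_box].
  rewrite mule_gt0//; rewrite (_ : (_ < _)%E = (0 < (r *+ 2)%:E)%E).
      by rewrite lte_fin pmulrn_lgt0.
    by congr (_ < _)%E; apply: lebesgue_measure_ball; exact: ltW.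
apply/seteqP; split => -[t y] /=.
  move=> h; split.
    by have := h ord0; rewrite mxE unlift_none /ball/= distrC.
  by move=> i; have := h (lift ord0 i); rewrite !mxE liftK.
move=> [h1 h2] i; rewrite mxE; case: unliftP => [j ->|->] /=.
  by have := h2 j; rewrite mxE.
by move: h1; rewrite /ball/= distrC.
Qed.

End null_and_positive_sets.

Section polar_coordinates.
Context {R : realType}.
Local Notation leb := (@lebesgue_measure R).
Local Notation lam n := (@lebesgue_rV R n).

Lemma is_derive_powR_primitive (p x : R) : p != 1 -> 0 < x ->
  is_derive x 1 (fun t : R => (1 - p)^-1 * t `^ (1 - p)) (x `^ (- p)).
Proof.
move=> p1 x0.
have := @is_deriveZ _ _ _ (@powR R ^~ (1 - p)) (1 - p)^-1 x 1 _ (is_derive1_powR (1 - p) x0).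
move/is_derive_eq; apply; rewrite /GRing.scale/= mulrA mulVf ?mul1r.
  by congr (_ `^ _); ring.
by rewrite subr_eq0 eq_sym.
Qed.

Lemma powR_cvgy0 (q : R) : 0 < q -> t `^ (- q) @[t --> +oo] --> (0 : R).
Proof.
move=> q0; apply/cvgr0Pnorm_lt => e e0.
near=> t.
have M0 : 0 < e `^ (- q^-1) by rewrite powR_gt0.
have tM : e `^ (- q^-1) < t by near: t; exact: nbhs_pinfty_gt.
rewrite ger0_norm ?powR_ge0// powRN.
have t0 := lt_trans M0 tM.
rewrite invf_plt ?posrE ?powR_gt0//.
rewrite (_ : e^-1 = (e `^ (- q^-1)) `^ q); last first.
  by rewrite -powRrM mulNr mulVf ?gt_eqF// powR_inv1// ltW.
by rewrite gt0_ltr_powR// ?nnegrE ?powR_ge0 ?ltW.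
Unshelve. all: by end_near. Qed.

Lemma integral_tail_powR (p r : R) : 1 < p -> 0 < r ->
  (\int[leb]_(t in `[r, +oo[) (t `^ (- p))%:E = ((p - 1)^-1 * r `^ (1 - p))%:E)%E.
Proof.
move=> p1 r0; pose F (t : R) := (1 - p)^-1 * t `^ (1 - p).
have dF (x : R) : 0 < x -> is_derive x 1 F (x `^ (- p)).
  by move=> x0; apply: is_derive_powR_primitive => //; rewrite gt_eqF.
have cF (x : R) : 0 < x -> {for x, continuous F}.
  move=> x0; apply: differentiable_continuous.
  by apply/derivable1_diffP; have [] := dF x x0.
have cont (x : R) : 0 < x -> {for x, continuous (fun t : R => t `^ (- p))}.
  move=> x0; apply: differentiable_continuous; apply/derivable1_diffP.
  by apply: derivable_powR; rewrite in_itv/= andbT.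
rewrite (@ge0_continuous_FTC2y _ _ F _ 0).
- rewrite sub0e -EFinN; congr EFin; rewrite /F -mulNr -invrN; congr (_^-1 * _).
  by ring.
- by move=> x _; exact: powR_ge0.
- apply/continuous_within_itvcyP.
  split; last by apply: cvg_at_right_filter; exact: cont.
  by move=> x; rewrite in_itv/= andbT => rx; apply: cont; rewrite (lt_trans r0).
- rewrite -[X in _ --> X](mulr0 (1 - p)^-1); apply: cvgMr.
  by rewrite (_ : 1 - p = - (p - 1)); [apply: powR_cvgy0; rewrite subr_gt0|ring].
- by move=> x rx; have [] := dF x (lt_trans r0 rx).
- by apply: cvg_at_right_filter; exact: cF.
- move=> x; rewrite in_itv/= andbT => rx; rewrite derive1E.
  by have [_ ->] := dF x (lt_trans r0 rx).
Qed.

Lemma integral_tail_power (n : nat) (r : R) : 0 < r ->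
  (\int[leb]_(t in `[r, +oo[) ((t ^- n.+2)%:E) =
    (n.+1%:R^-1 * r ^- n.+1)%:E)%E.
Proof.
move=> r0; transitivity (\int[leb]_(t in `[r, +oo[) (t `^ (- n.+2%:R))%:E)%E.
  apply: eq_integral => t; rewrite inE/= in_itv/= andbT => rt.
  by rewrite powRN powR_mulrn// (le_trans _ rt)// ltW.
rewrite integral_tail_powR//; last by rewrite ltr1n.
have n2 : n.+2%:R - 1 = n.+1%:R :> R by rewrite -natr1 addrK.
by rewrite n2 -opprB n2 powRN powR_mulrn// ltW.
Qed.

(** Dilations are the only changes of variable. Replacing t by |y| t turns the radial integral into
    |y|^(n+1) times that of t^n h(t y). After exchanging the integrals, z = t y at fixed t gives
    t^(-n-2) |z|^(n+1) h(z) on |z| <= t, and integrating t over [|z|, oo[ leaves h(z)/(n+1). Since h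
    0 = 0, the origin, missing from the punctured ball, needs no separate treatment. *)
Lemma polar_tonelli n (h : 'rV[R]_n.+1 -> R) : measurable_fun setT h ->
  (forall x, 0 <= h x) -> h 0 = 0 ->
  (\int[lam n.+1]_(y in @punctured_ball R n.+1) \int[leb]_(t in `]0%R, +oo[)
     (t ^+ n * h (t *: normalize y))%:E =
   (n.+1%:R^-1)%:E * \int[lam n.+1]_z (h z)%:E)%E.
Proof.
move=> mh h0 hz.
pose pos (t : R) : R := \1_(`]0, +oo[%classic : set R) t.
pose pb (y : 'rV[R]_n.+1) : R := \1_(@punctured_ball R n.+1) y.
have pos_ge0 t : 0 <= pos t by rewrite /pos indicE.
have pb_ge0 t : 0 <= pb t by rewrite /pb indicE.
have mpos : measurable_fun setT pos by apply: measurable_indic.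
have mpb : measurable_fun setT pb.
  by apply: measurable_indic; exact: measurable_punctured_ball.
have men := @measurable_enorm R n.+1.
have mscal : measurable_fun setT (fun p : 'rV[R]_n.+1 * R => p.2 *: p.1).
  apply: measurable_rVP => i; under eq_fun do rewrite mxE.
  apply: measurable_funM; first exact: measurable_snd.
  apply: (measurableT_comp (measurable_coord i)); exact: measurable_fst.
have posE t : pos t = (0 < t)%R%:R.
  by rewrite /pos indicE mem_setE in_itv/= andbT.
have pbm y : (y \in @punctured_ball R n.+1) = (0 < enorm y <= 1)%R.
  by apply/idP/idP => [/set_mem|H]; last exact/mem_set.
have pbE y : pb y = (0 < enorm y <= 1)%R%:R by rewrite /pb indicE pbm.
pose F1 (p : 'rV[R]_n.+1 * R) : R :=
  pb p.1 * enorm p.1 ^+ n.+1 * (pos p.2 * p.2 ^+ n * h (p.2 *: p.1)).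
have F1_ge0 p : 0 <= F1 p.
  rewrite /F1 posE; case: ltP => [t0|_]; last by rewrite !mul0r mulr0.
  by rewrite !mulr_ge0// ?exprn_ge0 ?enorm_ge0// ltW.
have mF1 : measurable_fun setT F1.
  apply: measurable_funM.
    apply: measurable_funM; first exact: (measurableT_comp mpb).
    apply: measurable_funX; exact: (measurableT_comp men).
  apply: measurable_funM; last exact: (measurableT_comp mh).
  apply: measurable_funM; first exact: (measurableT_comp mpos).
  by apply: measurable_funX; exact: measurable_snd.
transitivity (\int[lam n.+1]_y \int[leb]_t (F1 (y, t))%:E)%E.
  rewrite integral_mkcond; apply: eq_integral => y _; rewrite patchE.
  rewrite /F1/= pbE pbm; case: ifPn => [/andP[y0 y1]|_]; last first.
    by under eq_integral do rewrite !mul0r; rewrite integral0.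
  rewrite mul1r.
  rewrite integral_mkcond.
  pose F t := (pos t * t ^+ n * h (t *: normalize y))%:E.
  have F0 t : (0 <= F t)%E.
    rewrite lee_fin posE; case: ltP => [t0|_]; last by rewrite !mul0r.
    by rewrite mulr_ge0// mul1r exprn_ge0// ltW.
  have mF : measurable_fun [set: R] F.
    apply/measurable_EFinP; apply: measurable_funM.
      by apply: measurable_funM => //; exact: measurable_funX.
    apply: measurableT_comp => //.
    apply: measurable_rVP => i; under eq_fun do rewrite mxE.
    exact: measurable_funM.
  transitivity (\int[leb]_t F t)%E.
    apply: eq_integral => t _; rewrite /F posE patchE mem_setE in_itv/= andbT.
    by case: ifPn => _; rewrite ?mul1r ?mul0r.
  have := ge0_integral_affine 0 y0 mF F0.
  move=> /(congr1 (fun z => (enorm y)%:E * z)%E).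
  rewrite muleA -EFinM mulfV ?gt_eqF// mul1e => <-.
  rewrite -ge0_integralZl_EFin ?ltW//; last by apply: (measurableT_comp mF);
    exact: measurable_affine.
  apply: eq_integral => t _; rewrite /F -EFinM; congr EFin.
  have -> : (enorm y * t + 0) *: normalize y = t *: y.
    by rewrite addr0 /normalize scalerA mulrAC mulfV ?gt_eqF// mul1r.
  rewrite addr0.
  rewrite !posE pmulr_rgt0// exprMn exprS; ring.
rewrite (@fubini_tonelli _ _ _ (measurableTypeR R) R (lam n.+1) leb (EFin \o F1));
  [|exact/measurable_EFinP|by move=> p; rewrite lee_fin].
pose le2 (p : R * 'rV[R]_n.+1) : R := \1_[set p : R * 'rV[R]_n.+1 | enorm p.2 <= p.1] p.
have le2E p : le2 p = (enorm p.2 <= p.1)%R%:R.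
  by rewrite /le2 indicE; congr ((nat_of_bool _)%:R); apply/idP/idP => [/set_mem|H];
    last exact/mem_set.
have mle2 : measurable_fun setT le2.
  apply: measurable_indic.
  rewrite (_ : [set _ | _] = (fun p : R * 'rV[R]_n.+1 => p.1 - enorm p.2) @^-1` `[0, +oo[%classic).
    apply: measurable_preimage => //; apply: measurable_funB; first exact: measurable_fst.
    exact: (measurableT_comp men).
  by apply/seteqP; split => p /=; rewrite in_itv/= andbT subr_ge0.
(* The inverse of t is written as a real power, whose measurability is known; the two agree for t >
   0. *)
pose F2 (p : R * 'rV[R]_n.+1) : R :=
  pos p.1 * (p.1 `^ (-1)) ^+ n.+2 * (le2 p * (enorm p.2 ^+ n.+1 * h p.2)).
have F2_ge0 p : 0 <= F2 p.
  rewrite /F2 posE le2E; case: ltP => [t0|_]; last by rewrite !mul0r.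
  apply: mulr_ge0; first by apply: mulr_ge0 => //; apply: exprn_ge0; exact: powR_ge0.
  by apply: mulr_ge0 => //; apply: mulr_ge0 => //; apply: exprn_ge0; exact: enorm_ge0.
have mF2 : measurable_fun setT F2.
  apply: measurable_funM.
    apply: measurable_funM; first exact: (measurableT_comp mpos).
    apply: measurable_funX.
    by apply: (measurableT_comp (measurable_powR (-1))); exact: measurable_fst.
  apply: measurable_funM => //.
  apply: measurable_funM; last exact: (measurableT_comp mh).
  by apply: measurable_funX; exact: (measurableT_comp men).
transitivity (\int[leb]_t \int[lam n.+1]_z (F2 (t, z))%:E)%E.
  apply: eq_integral => t _; rewrite /F1 /F2 /= posE.
  case: ltP => t0; last first.
    by under eq_integral do rewrite !mul0r mulr0;
       under [RHS]eq_integral do rewrite !mul0r.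
  have t1 : t != 0 by rewrite gt_eqF.
  pose G z := (le2 (t, z) * (enorm z / t) ^+ n.+1 * t ^+ n * h z)%:E.
  have G0 z : (0 <= G z)%E.
    by rewrite lee_fin le2E !mulr_ge0// ?exprn_ge0// ?divr_ge0 ?enorm_ge0// ltW.
  have mG : measurable_fun setT G.
    apply/measurable_EFinP; apply: measurable_funM => //.
    apply: measurable_funM => //; apply: measurable_funM.
      by apply: (measurableT_comp mle2); exact: pair1_measurable.
    by apply: measurable_funX; apply: measurable_funM.
  transitivity (\int[lam n.+1]_y G (t *: y + 0)%R)%E.
    apply: eq_integral => y _; rewrite /G addr0 pbE le2E enormZ gtr0_norm//=; congr EFin.
    have -> : (t * enorm y <= t) = (enorm y <= 1).
      by rewrite -[X in _ <= X]mulr1 ler_pM2l.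
    have -> : t * enorm y / t = enorm y by rewrite mulrAC mulfV// mul1r.
    rewrite mul1r.
    have [->|y0] := eqVneq y 0; first by rewrite scaler0 hz !mulr0.
    rewrite enorm_gt0 y0 /=; ring.
  rewrite ge0_integral_rV_affine// -ge0_integralZl_EFin// ?invr_ge0 ?exprn_ge0 ?ltW//.
  apply: eq_integral => z _; rewrite /G -EFinM mul1r powR_inv1 ?ltW//; congr EFin.
  rewrite !exprS !invfM exprMn; have tn0 : t ^+ n != 0 by rewrite expf_eq0 (negbTE t1) andbF.
  rewrite exprVn; field; rewrite t1 tn0//.
rewrite (@fubini_tonelli _ _ (measurableTypeR R) _ R leb (lam n.+1) (EFin \o F2));
  [|exact/measurable_EFinP|by move=> p; rewrite lee_fin].
rewrite -ge0_integralZl_EFin//; last 2 first.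
  by move=> z _; rewrite lee_fin.
  exact/measurable_EFinP.
apply: eq_integral => z _.
have [->|z0] := eqVneq z 0.
  by under eq_integral do rewrite /F2/= hz !mulr0; rewrite integral0 hz mule0.
have e0 : 0 < enorm z by rewrite enorm_gt0.
transitivity (\int[leb]_(t in `[enorm z, +oo[) ((enorm z ^+ n.+1 * h z)%:E * (t ^- n.+2)%:E))%E.
  rewrite [RHS]integral_mkcond; apply: eq_integral => t _.
  rewrite /F2/= posE le2E patchE mem_setE in_itv/= andbT.
  case: ifPn => zt; last by rewrite mul0r mulr0.
  have t0 := lt_le_trans e0 zt.
  by rewrite t0 -EFinM powR_inv1 ?ltW//; congr EFin; rewrite exprVn !mul1r mulrC.
rewrite ge0_integralZl_EFin//; last 3 first.
  by move=> t; rewrite /= in_itv/= andbT => zt;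
    rewrite lee_fin invr_ge0 exprn_ge0// (le_trans _ zt)// ltW.
  apply/measurable_EFinP;
    apply: (@eq_measurable_fun _ _ _ _ _ (fun t : R => (t `^ (-1)) ^+ n.+2)) => [t|].
      rewrite inE/= in_itv/= andbT => zt.
      by rewrite powR_inv1 ?exprVn// (le_trans _ zt)// ltW.
    by apply: measurable_funX; apply: measurable_funTS; exact: measurable_powR.
  by rewrite mulr_ge0// exprn_ge0// ltW.
rewrite integral_tail_power// -!EFinM; congr EFin.
have E0 : enorm z ^+ n.+1 != 0 by rewrite expf_eq0 (gt_eqF e0) andbF.
by rewrite [X in _ * X]mulrC mulrA [_ * h z / _]mulrAC mulfV// mul1r mulrC.
Qed.

End polar_coordinates.

Section surface_integral.
Context {R : realType}.
Local Notation leb := (@lebesgue_measure R).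
Local Notation lam n := (@lebesgue_rV R n).

(** [mu] is the sum of its restrictions to D and to the complement. The function equal to f on D and
    to 0 elsewhere is almost everywhere f for the first restriction and 0 for the second. *)
Lemma ge0_integral_mrestr d (T : measurableType d) (mu : {measure set T -> \bar R})
    (D : set T) (mD : measurable D) (f : T -> \bar R) :
  measurable_fun setT f -> (forall x, 0 <= f x)%E ->
  (\int[mrestr mu mD]_x f x = \int[mu]_(x in D) f x)%E.
Proof.
move=> mf f0; have mDC := measurableC mD.
have mfD : measurable_fun setT (f \_ D).
  by apply/(measurable_restrictT f mD); exact: measurable_funTS.
have fD0 x : (0 <= (f \_ D) x)%E by rewrite patchE; case: ifP.
rewrite [RHS]integral_mkcond.
rewrite [RHS](eq_measure_integral (measure_add (mrestr mu mD) (mrestr mu mDC)));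
  last first.
  move=> A mA _; transitivity (mrestr mu mD A + mrestr mu mDC A)%E; last first.
    exact/esym/measure_addE.
  rewrite /mrestr -measureU.
  - by rewrite -setIUr setUv setIT.
  - exact: measurableI.
  - exact: measurableI.
  - by rewrite setIACA setICr setI0.
rewrite ge0_integral_measure_add//.
rewrite [X in (_ + X)%E](_ : _ = 0%E) ?adde0.
  apply: ge0_ae_eq_integral => //.
  exists (~` D); split => //.
    by rewrite /= /mrestr setICl measure0.
  move=> x /= H Dx; apply: H => _; rewrite patchE ifT//; exact/mem_set.
rewrite -[RHS](integral0 (mrestr mu mDC) setT).
apply: ge0_ae_eq_integral => //.
exists D; split => //; first by rewrite /= /mrestr setICr measure0.
move=> x /= H; apply: contrapT => Dx; apply: H => _; rewrite patchE ifF//.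
by apply/negbTE/negP => /set_mem.
Qed.

Lemma measurable_unit_sphere n : measurable (@unit_sphere R n).
Proof.
rewrite (_ : @unit_sphere R n = @enorm R n @^-1` [set 1])//.
by apply: measurable_preimage => //; exact: measurable_enorm.
Qed.

(** [surface_measure] is n times the image under [normalize] of Lebesgue measure on the punctured
    ball, and [normalize] sends that ball into the sphere. *)
Lemma ge0_integral_surface n (f : 'rV[R]_n -> \bar R) :
  measurable_fun setT f -> (forall x, 0 <= f x)%E ->
  (\int[@surface_measure R n]_(xi in @unit_sphere R n) f xi =
   n%:R%:E * \int[lam n]_(y in @punctured_ball R n) f (normalize y))%E.
Proof.
move=> mf f0.
have mPB := @measurable_punctured_ball R n.
have mN := @measurable_normalize R n.
have mS := @measurable_unit_sphere n.
have n0 : 0 <= n%:R :> R by [].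
pose nu := @mscale _ _ R (NngNum n0) (pushforward (mrestr (lam n) mPB) (@normalize R n)).
rewrite (eq_measure_integral (nu mN)); last first.
  by move=> A mA _; rewrite /nu /= /mscale/= /pushforward /mrestr /surface_measure setIC.
rewrite ge0_integral_mscale//; last exact: measurable_funTS.
rewrite ge0_integral_pushforward//; last exact: measurable_funTS.
congr (_ * _)%E.
rewrite integral_mkcond ge0_integral_mrestr.
- apply: eq_integral => y /set_mem; rewrite /punctured_ball/= => /andP[y0 _].
  rewrite patchE ifT//; apply/mem_set => /=.
  by rewrite /unit_sphere/= /normalize enormZ gtr0_norm ?invr_gt0// mulVf ?gt_eqF.
- apply/(measurable_restrictT (f \o normalize (n:=n))).
    exact: measurable_preimage.
  by apply: measurable_funTS; exact: measurableT_comp.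
- by move=> y; rewrite patchE; case: ifP => // _; exact: f0.
Qed.

(** [polar_tonelli] is applied to |h|, which gives integrability on the product, and then to the
    positive and negative parts. The radial integral [I] may fail to be finite in a null set of
    directions; [fine] gives 0 there, and [aeF] shows that this does not change the integral. *)
Lemma polar_coordinates n (h : 'rV[R]_n.+1 -> R) : h 0 = 0 ->
  (lam n.+1).-integrable setT (EFin \o h) ->
  \int[@surface_measure R n.+1]_(xi in @unit_sphere R n.+1)
     \int[leb]_(t in `]0, +oo[) (t ^+ n * h (t *: xi)) = \int[lam n.+1]_z h z.
Proof.
move=> h0 ih.
have mh : measurable_fun setT h by apply/measurable_EFinP; exact: measurable_int ih.
have mS := @measurable_unit_sphere n.+1.
pose pos (t : R) : R := \1_(`]0, +oo[%classic : set R) t.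
have mpos : measurable_fun setT pos by apply: measurable_indic.
have posE t : pos t = (0 < t)%R%:R.
  by rewrite /pos indicE mem_setE in_itv/= andbT.
pose K (p : 'rV[R]_n.+1 * measurableTypeR R) : \bar R :=
  (pos p.2 * p.2 ^+ n * h (p.2 *: p.1))%:E.
have mK : measurable_fun setT K.
  apply/measurable_EFinP; apply: measurable_funM.
    apply: measurable_funM; first exact: (measurableT_comp mpos).
    by apply: measurable_funX; exact: measurable_snd.
  apply: (measurableT_comp mh); apply: measurable_rVP => i.
  under eq_fun do rewrite mxE.
  apply: measurable_funM; first exact: measurable_snd.
  apply: (measurableT_comp (measurable_coord i)); exact: measurable_fst.
pose I (xi : 'rV[R]_n.+1) : \bar R := (\int[leb]_t K (xi, t))%E.
have mI : measurable_fun setT I.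
  rewrite (_ : I = (fubini_F leb K^\+ \- fubini_F leb K^\-)%E); last first.
    apply/funext => xi; rewrite /I integralE.
    by congr (_ - _)%E; apply: eq_integral => t _; rewrite ?funeposE ?funenegE.
  by apply: emeasurable_funB; apply: measurable_fun_fubini_tonelli_F => //;
    [exact: measurable_funepos|exact: measurable_funeneg].
pose F xi := fine (I xi).
have mF : measurable_fun setT (EFin \o F).
  by apply/measurable_EFinP; apply: measurableT_comp.
have FE xi : \int[leb]_(t in `]0, +oo[) (t ^+ n * h (t *: xi)) = F xi.
  rewrite Rintegral_mkcond /F /I /Rintegral; congr fine.
  apply: eq_integral => t _; rewrite /K/= posE patchE mem_setE in_itv/= andbT.
  by case: ifPn => _; rewrite ?mul1r ?mul0r.
rewrite (_ : (fun xi => _) = F); last exact/funext.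
rewrite /Rintegral.
pose PB := @punctured_ball R n.+1.
have mPB : measurable PB := @measurable_punctured_ball R n.+1.
have mN := @measurable_normalize R n.+1.
pose H (p : 'rV[R]_n.+1 * measurableTypeR R) : \bar R :=
  ((\1_PB p.1)%:E * K (normalize p.1, p.2))%E.
have mnK : measurable_fun setT (fun p : 'rV[R]_n.+1 * measurableTypeR R => K (normalize p.1, p.2)).
  apply: (measurableT_comp mK); apply/measurable_fun_pairP; split => /=.
    by apply: (measurableT_comp mN); exact: measurable_fst.
  exact: measurable_snd.
have m1 : measurable_fun setT (fun p : 'rV[R]_n.+1 * measurableTypeR R => (\1_PB p.1 : R)%:E).
  apply/measurable_EFinP; apply: (measurableT_comp (measurable_indic mPB)); exact: measurable_fst.
have mH : measurable_fun setT H by apply: emeasurable_funM.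
have polar (k : 'rV[R]_n.+1 -> R) (G : 'rV[R]_n.+1 * measurableTypeR R -> \bar R) :
  measurable_fun setT k -> (forall x, 0 <= k x) -> k 0 = 0 ->
  (forall y t, G (y, t) = ((\1_PB y)%:E * (pos t * t ^+ n * k (t *: normalize y))%:E)%E) ->
  (\int[lam n.+1]_y \int[leb]_t G (y, t) =
   (n.+1%:R^-1)%:E * \int[lam n.+1]_z (k z)%:E)%E.
  move=> mk k0 kz GE; rewrite -(polar_tonelli mk k0 kz) [RHS]integral_mkcond.
  apply: eq_integral => y _; rewrite patchE.
  case: ifPn => yPB.
    rewrite [RHS]integral_mkcond; apply: eq_integral => t _.
    rewrite GE indicE yPB mul1e patchE mem_setE in_itv/= andbT posE.
    by case: ifPn => _; rewrite ?mul1r ?mul0r.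
  rewrite integral0_eq// => t _; rewrite GE indicE (negbTE yPB) mul0e//.
have posM (y : 'rV[R]_n.+1) (t : R) : 0 <= (\1_PB y : R) * (pos t * t ^+ n).
  apply: mulr_ge0; first by rewrite indicE.
  by rewrite posE; case: ltP => t0; rewrite ?mul0r// mul1r exprn_ge0// ltW.
have iH : (lam n.+1 \x leb)%E.-integrable setT H.
  apply/integrable12ltyP => //.
  rewrite (polar (fun z => `|h z|) (abse \o H)); last 4 first.
  - exact: measurableT_comp.
  - by [].
  - by rewrite h0 normr0.
  - move=> y t; rewrite /H /K /= -!EFinM; congr EFin.
    by rewrite mulrA normrM ger0_norm ?posM// -mulrA.
  rewrite lte_mul_pinfty ?lee_fin//.
  by move/integrableP : ih => [_].
have normI y : PB y -> I (normalize y) = (\int[leb]_t H (y, t))%E.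
  move=> By; apply: eq_integral => t _; rewrite /H indicE /=.
  by rewrite mem_set// mul1e.
have aeF : ae_eq (lam n.+1) PB (fun y => (F (normalize y))%:E)
    (fun y => \int[leb]_t H (y, t))%E.
  apply: filterS (ae_integrable1 iH) => y iy By.
  rewrite /F normI// fineK//; apply: integrable_fin_num => //.
have mIH : measurable_fun setT (fun y => \int[leb]_t H (y, t))%E.
  exact: (measurable_fubini_F iH).
have mFN : measurable_fun setT (fun y => (F (normalize y))%:E).
  by apply: (measurableT_comp mF).
have key : (\int[lam n.+1]_(y in PB) (F (normalize y))%:E =
    (n.+1%:R^-1)%:E * \int[lam n.+1]_z (h z)%:E)%E.
  transitivity (\int[lam n.+1]_(y in PB) \int[leb]_t H (y, t))%E.
    by apply: ae_eq_integral => //; exact: measurable_funTS.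
  transitivity (\int[lam n.+1]_y \int[leb]_t H (y, t))%E.
    rewrite integral_mkcond; apply: eq_integral => y _; rewrite patchE.
    case: ifPn => // yPB; rewrite integral0_eq// => t _.
    by rewrite /H/= indicE (negbTE yPB) mul0e.
  rewrite (integral12_prod_meas1 iH) integralE [X in (_ * X)%E]integralE.
  rewrite fubini_tonelli1//; last exact: measurable_funepos.
  rewrite fubini_tonelli1//; last exact: measurable_funeneg.
  rewrite /fubini_F (polar (fun z => Num.max (h z) 0) H^\+%E); last 4 first.
  - exact: measurable_maxr.
  - by move=> x; rewrite le_max lexx orbT.
  - by rewrite h0 maxxx.
  - move=> y t; rewrite funeposE /H /K /= -!EFinM -EFin_max; congr EFin.
    by rewrite !mulrA -[X in Num.max _ X](mulr0 (\1_PB y * pos t * t ^+ n)) maxr_pMr// -mulrA posM.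
  rewrite (polar (fun z => Num.max (- h z) 0) H^\-%E); last 4 first.
  - by apply: measurable_maxr => //; exact: measurableT_comp.
  - by move=> x; rewrite le_max lexx orbT.
  - by rewrite h0 oppr0 maxxx.
  - move=> y t; rewrite funenegE /H /K /= -!EFinM -EFin_max; congr EFin.
    rewrite !mulrA -mulrN -[X in Num.max _ X](mulr0 (\1_PB y * pos t * t ^+ n)).
    by rewrite maxr_pMr// -mulrA posM.
  set P := (\int[_]_z (Num.max (h z) 0)%:E)%E.
  set N := (\int[_]_z (Num.max (- h z) 0)%:E)%E.
  have NE : (\int[lam n.+1]_z (EFin \o h)^\- z = N)%E.
    by apply: eq_integral => z _; rewrite funenegE -EFin_max.
  have PE : (\int[lam n.+1]_z (EFin \o h)^\+ z = P)%E.
    by apply: eq_integral => z _; rewrite funeposE -EFin_max.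
  have Nf : N \is a fin_num by rewrite -NE integrable_neg_fin_num.
  rewrite -[in LHS]muleBr// ?fin_num_adde_defl ?fin_numN//.
  by rewrite -PE -NE.
rewrite integralE ge0_integral_surface//; last exact: measurable_funepos.
rewrite ge0_integral_surface//; last exact: measurable_funeneg.
have iF : (lam n.+1).-integrable PB (fun y => (F (normalize y))%:E).
  apply/integrableP; split; first exact: measurable_funTS.
  rewrite (@ge0_ae_eq_integral _ _ _ _ _ _ (fun y => `|\int[leb]_t H (y, t)|)%E)//.
  - have /integrableP[_ +] := integrable_fubini_F iH.
    apply: le_lt_trans; apply: ge0_subset_integral => //.
    exact: measurableT_comp.
  - by apply: measurableT_comp => //; exact: measurable_funTS.
  - by apply: measurableT_comp => //; exact: measurable_funTS.
  - exact: ae_eq_abse.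
rewrite (_ : (_ - _)%E = (n.+1%:R%:E * \int[lam n.+1]_(y in PB) (F (normalize y))%:E)%E).
  by rewrite key muleA -EFinM mulfV ?mul1e// pnatr_eq0.
rewrite [in RHS]integralE.
have Nf := integrable_neg_fin_num mPB iF.
set N := (\int[_]_(_ in PB) _)%E in Nf *; set P := (\int[_]_(_ in PB) _)%E.
rewrite [RHS]muleBr ?fin_num_adde_defl ?fin_numN//.
by congr (_ * _ - _ * _)%E; apply: eq_integral => z _; rewrite ?funeposE ?funenegE.
Qed.

End surface_integral.

(** * Zeros and derivatives *)

Section nondegenerate_zeros.
Context {R : realType}.

(** A zero with nonzero derivative is isolated. Zeros isolated at distance 1/(k+1) are at least that
    far apart, so the floor of t(k+1) tells them apart; Z is the union over k. *)
Lemma countable_nondegenerate_zeros (phi psi : R -> R) (Z : set R) :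
  (forall t, Z t -> [/\ phi t = 0, is_derive t 1 phi (psi t) & psi t != 0]) ->
  countable Z.
Proof.
move=> HZ.
pose Zk k := [set t | Z t /\ forall u, `|u - t| < k.+1%:R^-1 -> u != t -> phi u != 0].
have cZk k : countable (Zk k).
  apply/countable_injP.
  exists (fun t => pickle (Num.floor (t * k.+1%:R))) => t u /set_mem[Zt Ht] /set_mem[Zu Hu].
  move/(pcan_inj pickleK) => tu; apply/eqP; apply: contraT => ntu.
  have [p0 _ _] := HZ _ Zt.
  suff : phi t != 0 by rewrite p0 eqxx.
  apply: (Hu t) => //.
  have k0 : 0 < k.+1%:R :> R by [].
  rewrite -(ltr_pM2r k0) mulVf ?gt_eqF// -{1}(gtr0_norm k0) -normrM mulrBl.
  have := floor_itv (t * k.+1%:R); have := floor_itv (u * k.+1%:R).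
  rewrite tu !intrD1 ltr_norml; set m := (Num.floor _)%:~R.
  by move=> /andP[? ?] /andP[? ?]; apply/andP; split; lra.
apply: (@sub_countable _ _ _ (\bigcup_k Zk k)); last exact: bigcup_countable.
apply: subset_card_le => t Zt.
have [p0 [dphi Dphi] psi0] := HZ _ Zt.
have := dphi; rewrite /derivable -/(derive phi t 1) => dcvg.
have {}dcvg : h^-1 *: (phi (h *: 1 + t) - phi t) @[h --> 0^'] --> psi t.
  by rewrite -Dphi; exact: dcvg.
(* With tolerance |psi t| the difference quotient cannot be 0 near t, whereas another zero of phi
   would make it 0. *)
move/cvgrPdist_lt : dcvg => /(_ `|psi t|); rewrite normr_gt0 => /(_ psi0).
rewrite near_withinE => -[e /= e0 He].
have [k ke] : exists k : nat, k.+1%:R^-1 < e.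
  by have [k _ /(_ k (leqnn k))] := near_infty_natSinv_lt (PosNum e0); exists k.
exists k => //; split => // u ut nut.
have := He (u - t); rewrite /= sub0r normrN (lt_trans ut ke) subr_eq0 => /(_ isT nut).
rewrite p0 subr0 /GRing.scale/= mulr1 subrK; apply: contraTneq => ->.
by rewrite mulr0 subr0 ltxx.
Qed.

End nondegenerate_zeros.

Section derivative_vanishes.
Context {R : realType} (n : nat).
Local Notation lam := (@lebesgue_rV R n).
Variables (V E : set 'rV[R]_n) (mV : measurable V) (EV : E `<=` V).

(** Stated through negligibility because E, in the end only Lebesgue measurable, need not belong to
    the Borel sigma-algebra. *)
Definition vanishes (u : 'rV[R]_n -> R) : Prop :=
  lam.-negligible (E `&` [set x | u x != 0]).

(** Outside the null set where u is nonzero, v can be nonzero only at nondegenerate zeros of u in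
    direction i. Taken over all of V, these zeros form a measurable set which meets each line in
    that direction in a countable set. *)
Lemma vanishes_derive (i : 'I_n) (u v : 'rV[R]_n -> R) :
  measurable_fun setT u -> measurable_fun setT v ->
  (forall x, V x -> is_derive (0 : R) 1 (fun h => u (x + h *: delta_mx 0 i)) (v x)) ->
  vanishes u -> vanishes v.
Proof.
move=> mu mv duv vu.
pose Z := V `&` [set x | u x = 0 /\ v x != 0].
have mZ : measurable Z.
  apply: measurableI => //.
  rewrite (_ : [set x | _] = u @^-1` [set 0] `&` v @^-1` (~` [set 0])).
    by apply: measurableI; apply: measurable_preimage => //; exact: measurableC.
  by apply/seteqP; split => x /= [? /eqP].
have Z0 : lam.-negligible Z.
  apply/negligibleP => //; apply: (null_of_countable_lines (i := i)) => // x.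
  apply: (@countable_nondegenerate_zeros _ (fun t => u (x + t *: delta_mx 0 i))
    (fun t => v (x + t *: delta_mx 0 i))) => t [Vt [ut vt]]; split => //.
  have := duv _ Vt.
  (* The derivative at 0 along the line based at x + t e_i becomes the derivative at t along the
     line based at x. *)
  have -> : (fun h : R => u (x + t *: delta_mx 0 i + h *: delta_mx 0 i)) =
      (fun h => u (x + (h + t) *: delta_mx 0 i)).
    by apply/funext => h; rewrite scalerDl addrAC addrA.
  move=> dt; have <- : (fun h => u (x + (h + t) *: delta_mx 0 i)) \o (fun h => h - t) =
      (fun h => u (x + h *: delta_mx 0 i)).
    by apply/funext => h /=; rewrite subrK.
  have dt' : is_derive (t - t) 1 (fun h => u (x + (h + t) *: delta_mx 0 i))
    (v (x + t *: delta_mx 0 i)) by rewrite subrr.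
  have ds : is_derive t 1 (fun h : R => h - t) (1 : R).
    have := @is_deriveB R R R id (cst t) t 1 1 0 (is_derive_id _ _) (is_derive_cst _ _ _).
    by rewrite subr0.
  by have := @is_derive1_comp R (fun h => u (x + (h + t) *: delta_mx 0 i))
    (fun h => h - t) t _ _ dt' ds; rewrite mulr1.
have := negligibleU vu Z0; apply: negligibleS => x [Ex vx].
have [ux|ux] := eqVneq (u x) 0; last by left.
by right; split => //; exact: EV.
Qed.

Lemma eq_vanishes (u v : 'rV[R]_n -> R) : (forall x, E x -> u x = v x) ->
  vanishes u -> vanishes v.
Proof.
move=> uv; apply: negligibleS => x [Ex] /=; rewrite -uv// => ux; split => //.
Qed.

Lemma vanishesD (u v : 'rV[R]_n -> R) : vanishes u -> vanishes v ->
  vanishes (fun x => u x + v x).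
Proof.
move=> vu vv; have := negligibleU vu vv; apply: negligibleS => x /= [Ex].
have [->|ux] := eqVneq (u x) 0; last by left.
by rewrite add0r => vx; right.
Qed.

Lemma vanishesZ (a : R) (u : 'rV[R]_n -> R) : vanishes u ->
  vanishes (fun x => a * u x).
Proof.
apply: negligibleS => x /= [Ex]; rewrite mulf_eq0 negb_or => /andP[_ ux].
by split.
Qed.

Lemma vanishes0 : vanishes (fun=> 0).
Proof.
rewrite /vanishes (_ : _ `&` _ = set0); first exact: negligible_set0.
by apply/seteqP; split => x //= [_]; rewrite eqxx.
Qed.

Lemma vanishes_sum (I : Type) (s : seq I) (u : I -> 'rV[R]_n -> R) :
  (forall i, vanishes (u i)) -> vanishes (fun x => \sum_(i <- s) u i x).
Proof.
move=> vu; elim: s => [|i s IH].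
  by apply: eq_vanishes vanishes0 => x _; rewrite big_nil.
apply: (eq_vanishes (u := fun x => u i x + \sum_(j <- s) u j x)).
  by move=> x _; rewrite big_cons.
exact: vanishesD.
Qed.

(** Countably many null sets cannot cover E; this yields one point at which all the conditions hold
    exactly. *)
Lemma vanishes_exists (T : countType) (u : T -> 'rV[R]_n -> R) :
  ~ lam.-negligible E -> (forall t, vanishes (u t)) ->
  exists2 x, E x & forall t, u t x = 0.
Proof.
move=> nE vu; apply: contrapT => H; apply: nE.
pose N k := if unpickle k is Some t then E `&` [set x | u t x != 0] else set0.
apply: (@negligibleS _ _ _ _ (\bigcup_k N k)).
  move=> x Ex; apply: contrapT => nN; apply: H; exists x => // t.
  apply/eqP; apply: contraT => ux; exfalso; apply: nN; exists (pickle t) => //.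
  by rewrite /N pickleK.
apply: negligible_bigcup => k; rewrite /N; case: unpickle => [t|]; first exact: vu.
exact: negligible_set0.
Qed.

End derivative_vanishes.

(** * Potentials *)

Lemma Rintegral_sum d (T : measurableType d) (R : realType)
    (mu : {measure set T -> \bar R}) (D : set T) (I : Type) (s : seq I)
    (f : I -> T -> R) : measurable D ->
  (forall i, mu.-integrable D (EFin \o f i)) ->
  \int[mu]_(x in D) (\sum_(i <- s) f i x) = \sum_(i <- s) \int[mu]_(x in D) f i x.
Proof.
move=> mD fi; elim: s => [|i s IH].
  rewrite big_nil /Rintegral integral0_eq// => x _; by rewrite big_nil.
rewrite big_cons -IH -RintegralD//; last first.
  rewrite (_ : _ \o _ = fun x => (\sum_(j <- s) (f j x)%:E)%E).
    by apply: integrable_sum => // j _; exact: fi.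
  by apply/funext => x /=; rewrite sumEFin.
by apply: eq_Rintegral => x _; rewrite big_cons.
Qed.

(** A plain disjunction: unlike [leP], splitting on it leaves the comparisons in the goal
    untouched. *)
Lemma ler_or_lt (R : realDomainType) (a c : R) : a <= c \/ c < a.
Proof. by case: leP => _; [left|right]. Qed.

Section kernels.
Context {R : realType} (n : nat).
Local Notation lam := (@lebesgue_rV R n).
Implicit Types (l : seq 'I_n) (b r : R) (x y z : 'rV[R]_n) (i : 'I_n).

(** Multi-indices are lists of indices: a new factor is a cons, and a derivative is a [rem] weighted
    by a multiplicity. *)
Definition mono l y : R := \prod_(i <- l) y 0 i.

Definition ker l b y : R := mono l y * enorm y `^ b.

Definition dker i l b y : R :=
  (count_mem i l)%:R * ker (rem i l) b y + b * ker (i :: l) (b - 2) y.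

(** Removes the singularity of the kernels. At a point x such that g vanishes within 2r of x, the
    convolution of g with the cut kernel is the one with the full kernel. *)
Definition cut r y : R := (r <= enorm y)%R%:R.

Lemma cut1 r y : r <= enorm y -> cut r y = 1.
Proof. by rewrite /cut => ->. Qed.

Lemma cut0 r y : enorm y < r -> cut r y = 0.
Proof. by rewrite /cut ltNge => /negbTE ->. Qed.

Lemma mono_cons i l y : mono (i :: l) y = y 0 i * mono l y.
Proof. exact: big_cons. Qed.

Lemma mono_rem i l y : i \in l -> y 0 i * mono (rem i l) y = mono l y.
Proof.
by move=> il; rewrite -mono_cons; apply/perm_big; rewrite perm_sym perm_to_rem.
Qed.

Lemma ker_perm l l' b y : perm_eq l l' -> ker l b y = ker l' b y.
Proof. by move=> ll'; congr (_ * _); exact: perm_big. Qed.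

Lemma normr_mono l y : `|mono l y| <= enorm y ^+ size l.
Proof.
elim: l => [|i l IH]; first by rewrite /mono big_nil normr1.
by rewrite mono_cons normrM exprS ler_pM// coord_le_enorm.
Qed.

Lemma powR_le_npos (r t p : R) : 0 < r -> r <= t -> p <= 0 -> t `^ p <= r `^ p.
Proof.
move=> r0 rt p0; rewrite -[p]opprK !(powRN _ (- p)).
rewrite lef_pV2 ?posrE ?powR_gt0// ?(lt_le_trans r0)//.
by rewrite ge0_ler_powR ?oppr_ge0// ?nnegrE ?ltW// (lt_le_trans r0).
Qed.

Lemma ker_bound r l b y : 0 < r -> (size l)%:R + b <= 0 -> r <= enorm y ->
  `|ker l b y| <= r `^ ((size l)%:R + b).
Proof.
move=> r0 lb ry; have y0 := lt_le_trans r0 ry.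
apply: le_trans (powR_le_npos r0 ry lb).
rewrite normrM (ger0_norm (powR_ge0 _ _)) powRD; last first.
  by rewrite (gt_eqF y0) implybT.
by rewrite ler_wpM2r ?powR_ge0// powR_mulrn ?enorm_ge0// normr_mono.
Qed.

Lemma cut_ker_bound r l b y : 0 < r -> (size l)%:R + b <= 0 ->
  `|cut r y * ker l b y| <= r `^ ((size l)%:R + b).
Proof.
move=> r0 lb; have [ry|ry] := leP r (enorm y).
  by rewrite cut1// mul1r ker_bound.
by rewrite cut0// mul0r normr0 powR_ge0.
Qed.

Lemma ker_contract l b y : 0 < enorm y ->
  \sum_i ker [:: i, i & l] b y = ker l (b + 2) y.
Proof.
move=> y0; rewrite /ker powRD; last by rewrite (gt_eqF y0) implybT.
rewrite (powR_mulrn 2) ?enorm_ge0// sqr_enorm mulrCA mulr_sumr.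
rewrite mulr_sumr; apply: eq_bigr => i _.
by rewrite !mono_cons; ring.
Qed.

Lemma is_derive_mono i l z (t : R) :
  is_derive t 1 (fun h : R => mono l (z + h *: delta_mx 0 i))
    ((count_mem i l)%:R * mono (rem i l) (z + t *: delta_mx 0 i)).
Proof.
elim: l => [|j l IH].
  rewrite (_ : (fun h => _) = cst 1); last by apply/funext => h; rewrite /mono big_nil.
  by rewrite mul0r; exact: is_derive_cst.
have dj : is_derive t 1 (fun h : R => z 0 j + h * (j == i)%:R) ((j == i)%:R : R).
  have d0 := @is_derive_cst R R R (z 0 j) t 1.
  have d1 := @is_deriveZ R R R id (j == i)%:R t 1 1 (is_derive_id t 1).
  have := is_deriveD d0 d1; rewrite add0r /GRing.scale/= mulr1.
  rewrite (_ : _ + _ = (fun h : R => z 0 j + h * (j == i)%:R))//.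
  by apply/funext => h; rewrite /GRing.scale/= mulrC.
have cE (h : R) : (z + h *: delta_mx 0 i) 0 j = z 0 j + h * (j == i)%:R.
  by rewrite !mxE eqxx.
have := @is_deriveM R R (fun h : R => z 0 j + h * (j == i)%:R)
  (fun h : R => mono l (z + h *: delta_mx 0 i)) t 1 _ _ dj IH.
rewrite (_ : _ * _ = (fun h => mono (j :: l) (z + h *: delta_mx 0 i))); last first.
  by apply/funext => h; rewrite mono_cons cE.
move/is_derive_eq; apply; rewrite /GRing.scale/= -cE.
have [<-|ji] := eqVneq j i; last first.
  rewrite mulr0 addr0 add0n mono_cons; ring.
rewrite mulr1 add1n -natr1; set w := z + _.
have [jl|jl] := boolP (j \in l); last by rewrite (count_memPn jl); ring.
by rewrite mulrCA mono_rem//; ring.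
Qed.

(** |z + h e_i|^2 is a quadratic polynomial in h, and the chain rule is applied to its power b/2. *)
Lemma is_derive_enorm_powR i b z (t : R) : 0 < enorm (z + t *: delta_mx 0 i) ->
  is_derive t 1 (fun h : R => enorm (z + h *: delta_mx 0 i) `^ b)
    (b * ((z + t *: delta_mx 0 i) 0 i * enorm (z + t *: delta_mx 0 i) `^ (b - 2))).
Proof.
move=> w0.
have sq (h : R) : enorm (z + h *: delta_mx 0 i) ^+ 2 =
    enorm z ^+ 2 + (2 * z 0 i) * h + h ^+ 2.
  rewrite !sqr_enorm (bigD1 i)//= [in RHS](bigD1 i)//= !mxE !eqxx mulr1.
  rewrite (eq_bigr (fun j => z 0 j ^+ 2)); first by ring.
  by move=> j ji; rewrite !mxE (negbTE ji) mulr0 addr0.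
have pw (w : 'rV[R]_n) (c : R) : (enorm w ^+ 2) `^ (c / 2) = enorm w `^ c.
  rewrite -(powR_mulrn 2) ?enorm_ge0// -powRrM; congr (_ `^ _); by field.
rewrite (_ : (fun h => _) = (fun q => q `^ (b / 2)) \o
    (fun h => enorm z ^+ 2 + (2 * z 0 i) * h + h ^+ 2)); last first.
  by apply/funext => h /=; rewrite -sq pw.
have dq : is_derive t 1 (fun h : R => enorm z ^+ 2 + (2 * z 0 i) * h + h ^+ 2)
    (2 * (z + t *: delta_mx 0 i) 0 i).
  have d1 := @is_deriveZ R R R id (2 * z 0 i) t 1 1 (is_derive_id t 1).
  have d2 := @is_deriveX R R id 2 t 1 1 (is_derive_id t 1).
  have d3 := @is_deriveD R R R _ _ t 1 _ _
    (@is_deriveD R R R _ _ t 1 _ _ (is_derive_cst (enorm z ^+ 2) t 1) d1) d2.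
  have := is_derive_eq d3; apply; rewrite /GRing.scale/= !mxE !eqxx/=; ring.
have q0 : 0 < enorm z ^+ 2 + (2 * z 0 i) * t + t ^+ 2 by rewrite -sq exprn_gt0.
have := @is_derive1_comp R _ (fun h => enorm z ^+ 2 + (2 * z 0 i) * h + h ^+ 2) t _ _
  (is_derive1_powR (b / 2) q0) dq.
move/is_derive_eq; apply; rewrite -sq.
rewrite (_ : b / 2 - 1 = (b - 2) / 2); last by field.
by rewrite pw; field.
Qed.

Lemma is_derive_ker i l b z (t : R) : 0 < enorm (z + t *: delta_mx 0 i) ->
  is_derive t 1 (fun h : R => ker l b (z + h *: delta_mx 0 i))
    (dker i l b (z + t *: delta_mx 0 i)).
Proof.
move=> w0.
have := @is_deriveM R R (fun h : R => mono l (z + h *: delta_mx 0 i))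
  (fun h : R => enorm (z + h *: delta_mx 0 i) `^ b) t 1 _ _
  (is_derive_mono i l z t) (is_derive_enorm_powR b w0).
move/is_derive_eq; apply.
rewrite /GRing.scale/= /dker /ker mono_cons; ring.
Qed.

Lemma measurable_mono l : measurable_fun setT (mono l).
Proof.
by apply: measurable_prod => i _; exact: measurable_coord.
Qed.

Lemma measurable_ker l b : measurable_fun setT (ker l b).
Proof.
apply: measurable_funM; first exact: measurable_mono.
exact: (measurableT_comp (measurable_powR b) (@measurable_enorm R n)).
Qed.

Lemma measurable_cut r : measurable_fun setT (cut r).
Proof.
rewrite (_ : cut r = \1_(@enorm R n @^-1` `[r, +oo[%classic)).
  apply: measurable_indic; apply: measurable_preimage => //.
  exact: measurable_enorm.
by apply/funext => y; rewrite indicE /cut; congr (nat_of_bool _)%:R;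
  apply/idP/idP => [ry|/set_mem/=]; [apply/mem_set|]; rewrite /= in_itv/= andbT.
Qed.

Lemma measurable_rVB : measurable_fun setT (fun p : 'rV[R]_n * 'rV[R]_n => p.1 - p.2).
Proof.
apply: measurable_rVP => i; under eq_fun do rewrite !mxE.
apply: measurable_funB.
  by apply: (measurableT_comp (measurable_coord i)); exact: measurable_fst.
by apply: (measurableT_comp (measurable_coord i)); exact: measurable_snd.
Qed.

Lemma measurable_rVBl x : measurable_fun setT (fun y : 'rV[R]_n => x - y).
Proof.
apply: measurable_rVP => i; under eq_fun do rewrite !mxE.
by apply: measurable_funB => //; exact: measurable_coord.
Qed.

Lemma integrableM_bounded (g k : 'rV[R]_n -> R) (C : R) :
  lam.-integrable setT (EFin \o g) -> measurable_fun setT k ->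
  (forall y, `|k y| <= C) -> lam.-integrable setT (EFin \o (fun y => g y * k y)).
Proof.
move=> ig mk kC; have mg : measurable_fun setT g.
  by apply/measurable_EFinP; exact: measurable_int ig.
apply: (@le_integrable _ _ _ _ _ measurableT _ (fun y => (C%:E * (g y)%:E)%E)) => //.
- by apply/measurable_EFinP; exact: measurable_funM.
- move=> y _; rewrite /= lee_fin !normrM mulrC ler_wpM2r//.
  by rewrite (le_trans (kC y))// ler_norm.
- exact: integrableZl.
Qed.

Section convolution.
Variables (g : 'rV[R]_n -> R) (r : R).
Hypotheses (ig : lam.-integrable setT (EFin \o g)) (r0 : 0 < r).

Definition conv l b x : R := \int[lam]_y (g y * (cut r (x - y) * ker l b (x - y))).

Let mg : measurable_fun setT g.
Proof. by apply/measurable_EFinP; exact: measurable_int ig. Qed.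

Lemma measurable_cut_ker l b x :
  measurable_fun setT (fun y => cut r (x - y) * ker l b (x - y)).
Proof.
apply: measurable_funM.
  exact: (measurableT_comp (measurable_cut r) (measurable_rVBl x)).
exact: (measurableT_comp (measurable_ker l b) (measurable_rVBl x)).
Qed.

Lemma integrable_conv l b x : (size l)%:R + b <= 0 ->
  lam.-integrable setT (EFin \o (fun y => g y * (cut r (x - y) * ker l b (x - y)))).
Proof.
move=> lb; apply: integrableM_bounded => //; first exact: measurable_cut_ker.
by move=> y; exact: cut_ker_bound.
Qed.

Lemma measurable_conv l b : measurable_fun setT (conv l b).
Proof.
pose K (p : 'rV[R]_n * 'rV[R]_n) : \bar R :=
  (g p.2 * (cut r (p.1 - p.2) * ker l b (p.1 - p.2)))%:E.
have mK : measurable_fun setT K.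
  apply/measurable_EFinP; apply: measurable_funM.
    by apply: (measurableT_comp mg); exact: measurable_snd.
  apply: measurable_funM.
    exact: (measurableT_comp (measurable_cut r) measurable_rVB).
  exact: (measurableT_comp (measurable_ker l b) measurable_rVB).
rewrite (_ : conv l b = fine \o (fubini_F lam K^\+%E \- fubini_F lam K^\-%E)%E); last first.
  apply/funext => x; rewrite /conv /Rintegral /= integralE; congr fine.
  by congr (_ - _)%E; apply: eq_integral => t _; rewrite ?funeposE ?funenegE.
apply: measurableT_comp => //.
by apply: emeasurable_funB; apply: measurable_fun_fubini_tonelli_F => //;
    [exact: measurable_funepos|exact: measurable_funeneg].
Qed.

Lemma conv_perm l l' b x : perm_eq l l' -> conv l b x = conv l' b x.
Proof.
by move=> ll'; apply: eq_Rintegral => y _; rewrite (ker_perm _ _ ll').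
Qed.

Lemma conv_contract l b x : (size l)%:R + b + 2 <= 0 ->
  \sum_i conv [:: i, i & l] b x = conv l (b + 2) x.
Proof.
move=> lb; have lb' i : (size [:: i, i & l])%:R + b <= 0.
  by apply: le_trans lb; rewrite /= -!natr1 addrAC [leRHS]addrAC; lra.
rewrite /conv -Rintegral_sum//; last by move=> i; exact: integrable_conv.
apply: eq_Rintegral => y _.
rewrite -mulr_sumr -mulr_sumr; have [rxy|rxy] := leP r (enorm (x - y)).
  by rewrite ker_contract// (lt_le_trans r0).
by rewrite cut0// !mul0r.
Qed.

(** The cut at |x + h e_i - y| = r moves with h and is discontinuous. For |h| < r it can be replaced
    by the fixed cut |x - y| >= 2r: inside, g is zero, and outside, the shifted point stays at
    distance at least r from the singularity. The integrand is then differentiable in h, with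
    derivative dominated by C |g|. *)
Lemma is_derive_conv i l b x : (size l)%:R + b <= 0 ->
  (forall y, enorm (x - y) < 2 * r -> g y = 0) ->
  is_derive (0 : R) 1 (fun h : R => conv l b (x + h *: delta_mx 0 i))
    ((count_mem i l)%:R * conv (rem i l) b x + b * conv (i :: l) (b - 2) x).
Proof.
move=> lb gx; set e : 'rV[R]_n := delta_mx 0 i.
have ee : enorm e = 1 := enorm_delta i.
have dke z (t : R) : 0 < enorm (z + t *: e) ->
    is_derive t 1 (fun h : R => ker l b (z + h *: e)) (dker i l b (z + t *: e)).
  exact: is_derive_ker.
clearbody e; have rr : 2 * r = r + r by ring.
move: (2 * r) rr gx => d rr gx.
have lb1 : (size (rem i l))%:R + b <= 0.
  by rewrite (le_trans _ lb)// lerD2r ler_nat size_subseq// rem_subseq.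
have lb2 : (size (i :: l))%:R + (b - 2) <= 0.
  by rewrite /= -natr1; lra.
pose f (h : R) y := g y * (cut d (x - y) * ker l b (x - y + h *: e)).
have far (h : R) y : `|h| < r -> d <= enorm (x - y) -> r <= enorm (x - y + h *: e).
  move=> hr xy; rewrite -(lerD2r (enorm (- (h *: e)))).
  apply: le_trans (ler_enormD _ _); rewrite addrK enormN enormZ ee mulr1.
  by apply: le_trans xy; rewrite rr lerD2l ltW.
have fE (h : R) : `|h| < r -> conv l b (x + h *: e) = \int[lam]_y f h y.
  move=> hr; apply: eq_Rintegral => y _; rewrite /f.
  have [xy|/gx gy0] := ler_or_lt d (enorm (x - y)); last first.
    by rewrite gy0; transitivity (0 : R); [exact: mul0r|exact/esym/mul0r].
  by rewrite [x + _ - y]addrAC !cut1//; exact: far.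
have Ir (h : R) : h \in `](- r), r[ -> `|h| < r by rewrite in_itv/= ltr_norml.
have dk (h : R) y : `|h| < r -> is_derive h 1 (f ^~ y)
    (g y * (cut d (x - y) * dker i l b (x - y + h *: e))).
  move=> hr; have [xy|xy] := ler_or_lt d (enorm (x - y)).
    rewrite /f cut1// mul1r.
    have w0 : 0 < enorm (x - y + h *: e) by rewrite (lt_le_trans r0)// far.
    have := @is_deriveZ R R R _ (g y) h 1 _ (dke _ _ w0).
    by rewrite /GRing.scale/= (_ : _ \*: _ = (fun h0 => g y * (1 * ker l b (x - y + h0 *: e))))//;
      apply/funext => h0; rewrite mul1r.
  rewrite (_ : f ^~ y = cst 0); last by apply/funext => h0; rewrite /f cut0// mul0r mulr0.
  by rewrite cut0// mul0r mulr0; exact: (is_derive_cst 0 h 1).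
pose C := (count_mem i l)%:R * r `^ ((size (rem i l))%:R + b) +
  `|b| * r `^ ((size (i :: l))%:R + (b - 2)).
have dkC (h : R) y : `|h| < r -> `|cut d (x - y) * dker i l b (x - y + h *: e)| <= C.
  move=> hr; have C0 : 0 <= C by rewrite addr_ge0// mulr_ge0 ?powR_ge0.
  have [xy|xy] := ler_or_lt d (enorm (x - y)); last by rewrite cut0// mul0r normr0.
  rewrite cut1// mul1r; apply: le_trans (ler_normD _ _) _;
    rewrite (normrM b) (normrM (count_mem i l)%:R).
  rewrite normr_nat; apply: lerD; apply: ler_wpM2l => //; apply: ker_bound => //;
    exact: far.
have mline (h : R) : measurable_fun setT (fun y => x - y + h *: e).
  rewrite (_ : (fun y => _) = fun y => (x + h *: e) - y); last first.
    by apply/funext => y; rewrite addrAC.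
  exact: measurable_rVBl.
have mcut2 : measurable_fun setT (fun y => cut d (x - y)).
  exact: (measurableT_comp (measurable_cut d) (measurable_rVBl x)).
have intf (h : R) : h \in `](- r), r[ -> lam.-integrable setT (EFin \o f h).
  move=> /Ir hr; apply: (@integrableM_bounded _ _ (r `^ ((size l)%:R + b))) => //.
    apply: measurable_funM => //.
    exact: (measurableT_comp (measurable_ker l b) (mline h)).
  move=> y; have [xy|xy] := ler_or_lt d (enorm (x - y)).
    by rewrite cut1// mul1r ker_bound// far.
  by rewrite cut0// mul0r normr0 powR_ge0.
have I0 : (`](- r), r[%classic : set R) 0 by rewrite /= in_itv/= r0 oppr_lt0 r0.
have derf1 (h : R) y : (`](- r), r[%classic : set R) h -> setT y -> derivable (f ^~ y) h 1.
  by move=> /Ir hr _; have [] := dk h y hr.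
have G0 y : 0 <= C * `|g y|.
  by rewrite mulr_ge0// (le_trans _ (dkC 0 y _))// ?normr0.
have iG : lam.-integrable setT (EFin \o (fun y => C * `|g y|)).
  rewrite (_ : _ \o _ = fun y => (C%:E * `|(g y)%:E|)%E)//.
  by apply: integrableZl => //; exact: integrable_abse.
have dE (h : R) y : `|h| < r -> partial1of2 f h y =
    g y * (cut d (x - y) * dker i l b (x - y + h *: e)).
  by move=> hr; rewrite partial1of2E; have [_ ->] := dk h y hr.
have Gub (h : R) y : (`](- r), r[%classic : set R) h -> setT y ->
    `|partial1of2 f h y| <= C * `|g y|.
  by move=> /Ir hr _; rewrite dE// normrM mulrC ler_wpM2r// dkC.
have vE : \int[lam]_y partial1of2 f 0 y =
   (count_mem i l)%:R * conv (rem i l) b x + b * conv (i :: l) (b - 2) x.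
  rewrite /conv -RintegralZl//; last exact: integrable_conv.
  rewrite -RintegralZl//; last exact: integrable_conv.
  rewrite -RintegralD//; last 2 first.
    rewrite (_ : _ \o _ = fun y => ((count_mem i l)%:R%:E *
        (g y * (cut r (x - y) * ker (rem i l) b (x - y)))%:E)%E)//.
    by apply: integrableZl => //; exact: integrable_conv.
  - rewrite (_ : _ \o _ = fun y => (b%:E *
        (g y * (cut r (x - y) * ker (i :: l) (b - 2) (x - y)))%:E)%E)//.
    by apply: integrableZl => //; exact: integrable_conv.
  have E0 z : z + (0 : R) *: e = z by rewrite scale0r addr0.
  have n0 : `|0 : R| < r by rewrite normr0.
  apply: eq_Rintegral => y _.
  rewrite (dE 0 y n0).
  rewrite E0.
  have [xy|/gx gy0] := ler_or_lt d (enorm (x - y)); last by rewrite gy0 !mul0r !mulr0 addr0.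
  rewrite !cut1//; first by rewrite /dker; ring.
  by rewrite (le_trans _ xy)// rr lerDl ltW.
apply: (@near_eq_is_derive _ _ _ (fun h => \int[lam]_y f h y)).
  near=> h; apply/esym/fE; near: h.
  by exists r => // z /=; rewrite sub0r normrN.
apply: DeriveDef.
  exact: (derivable_under_integral measurableT I0 intf derf1 G0 iG Gub).
by rewrite -vE -derive1E (differentiation_under_integral measurableT I0 intf derf1 G0 iG Gub).
Unshelve. all: by end_near. Qed.

End convolution.
End kernels.

(** * Unique continuation *)

Section ladder.
Context {R : realType} (n : nat).
Local Notation lam := (@lebesgue_rV R n).
Variables (V E : set 'rV[R]_n) (mV : measurable V) (EV : E `<=` V).
Variables (g : 'rV[R]_n -> R) (r : R).
Hypotheses (ig : lam.-integrable setT (EFin \o g)) (r0 : 0 < r).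
Hypothesis gV : forall x y, V x -> enorm (x - y) < 2 * r -> g y = 0.
Local Notation vn := (vanishes E).
Local Notation cv := (conv g r).

Lemma vanishes_conv_derive (i : 'I_n) l b : (size l)%:R + b <= 0 ->
  vn (cv l b) ->
  vn (fun x => (count_mem i l)%:R * cv (rem i l) b x + b * cv (i :: l) (b - 2) x).
Proof.
move=> lb; apply: (@vanishes_derive _ _ V _ mV EV i) => //.
- exact: measurable_conv.
- by apply: measurable_funD; apply: measurable_funM => //; exact: measurable_conv.
- by move=> x Vx; apply: is_derive_conv => // y; exact: gV.
Qed.

(** The derivative consists of a term with the additional factor y_i and, when i occurs in l, a term
    with one factor y_i removed. The latter being known to vanish, the relation is solved for the
    former. *)
Lemma vanishes_conv_cons (i : 'I_n) l b : (size l)%:R + b <= 0 -> b != 0 ->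
  vn (cv l b) -> (i \in l -> vn (cv (rem i l) b)) -> vn (cv (i :: l) (b - 2)).
Proof.
move=> lb b0 vl vr; have := vanishes_conv_derive i lb vl.
have [il|il] := boolP (i \in l).
  move=> /(vanishesD (vanishesZ (- (count_mem i l)%:R) (vr il)))/(vanishesZ b^-1).
  by apply: eq_vanishes => x _; rewrite mulNr addKr mulrA mulVf// mul1r.
move/(vanishesZ b^-1); apply: eq_vanishes => x _.
by rewrite (count_memPn il) mul0r add0r mulrA mulVf// mul1r.
Qed.

(** The Laplacian of |y|^b is b(b+n-2) |y|^(b-2), and neither factor is zero. *)
Lemma vanishes_conv_laplacian (b : R) : b < 0 -> b + n%:R < 2 ->
  vn (cv [::] b) -> vn (cv [::] (b - 2)).
Proof.
move=> b0 bn vb.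
have v1 i : vn (cv [:: i] (b - 2)).
  by apply: vanishes_conv_cons => //=; [rewrite add0r ltW|rewrite lt_eqF].
have v2 i : vn (fun x => cv [::] (b - 2) x + (b - 2) * cv [:: i; i] (b - 2 - 2) x).
  have s1 : (size [:: i])%:R + (b - 2) <= 0 by rewrite /=; lra.
  have := vanishes_conv_derive i s1 (v1 i); apply: eq_vanishes => x _.
  by rewrite /= eqxx addn0 mul1r.
have := vanishesZ (n%:R + b - 2)^-1 (vanishes_sum (index_enum 'I_n) v2).
apply: eq_vanishes => x _.
rewrite big_split/= sumr_const card_ord -mulr_sumr conv_contract//=; last lra.
have -> : b - 2 - 2 + 2 = b - 2 by ring.
have d0 : n%:R + b - 2 != 0 by rewrite lt_eqF//; lra.
by rewrite -[_ *+ n]mulr_natl; field.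
Qed.

(* The kernels [p(y) |y|^(c-2k-2j)], [p] a monomial of degree [k], are spanned
   by the derivatives of [|y|^c] of order [k + 2j]. *)
Lemma vanishes_conv_ladder (c : R) : c < 0 -> c + n%:R < 2 -> vn (cv [::] c) ->
  forall l, vn (cv l (c - 2 * (size l)%:R)).
Proof.
move=> c0 cn vc.
have v0 j : vn (cv [::] (c - 2 * j%:R)).
  elim: j => [|j IH]; first by rewrite mulr0 subr0.
  have j0 : 0 <= j%:R :> R by [].
  rewrite -natr1 (_ : _ - _ = c - 2 * j%:R - 2); last by ring.
  by apply: vanishes_conv_laplacian => //; lra.
(* Removing an index at fixed exponent leaves the family with j = 0: one index less is compensated
   by one Laplacian more, j+1. The bound k allows the induction to be used for both l and
   [rem i l]. *)
suff H k l j : (size l <= k)%N -> vn (cv l (c - 2 * (size l)%:R - 2 * j%:R)).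
  by move=> l; have := H _ l 0 (leqnn _); rewrite mulr0 subr0.
elim: k l j => [|k IH] [|i l] j lk.
- by rewrite mulr0 subr0; exact: v0.
- by exfalso; exact: (notF lk).
- by rewrite mulr0 subr0; exact: v0.
have l0 : 0 <= (size l)%:R :> R by [].
have j0 : 0 <= j%:R :> R by [].
have -> : c - 2 * (size (i :: l))%:R - 2 * j%:R = c - 2 * (size l)%:R - 2 * j%:R - 2.
  by rewrite /= -[(size l).+1%:R]natr1; ring.
apply: vanishes_conv_cons.
- lra.
- by rewrite lt_eqF//; lra.
- exact: IH.
- move=> il; have := IH (rem i l) j.+1; rewrite (size_rem il) => IHl.
  have sl : (0 < size l)%N by case: (l) il.
  have E1 : c - 2 * (size l)%:R - 2 * j%:R =
      c - 2 * (size l).-1%:R - 2 * j.+1%:R.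
    by rewrite -{1}(prednK sl) -[(size l).-1.+1%:R]natr1 -[j.+1%:R]natr1; ring.
  by rewrite E1; apply: IHl; exact: leq_trans (leq_pred _) _.
Qed.

End ladder.

(** * Bounded functions orthogonal to an integrable weight *)

Section weighted_integral.
Context {R : realType} d (T : measurableType d) (mu : {measure set T -> \bar R}).
Variable H : T -> R.
Hypothesis iH : mu.-integrable setT (EFin \o H).

Definition bounded_measurable (phi : T -> R) : Prop :=
  measurable_fun setT phi /\ exists C, forall y, `|phi y| <= C.

Lemma integrable_weighted phi : bounded_measurable phi ->
  mu.-integrable setT (EFin \o (fun y => H y * phi y)).
Proof.
move=> [mphi [C phiC]]; have mH : measurable_fun setT H.
  by apply/measurable_EFinP; exact: measurable_int iH.
apply: (@le_integrable _ _ _ _ _ measurableT _ (fun y => (C%:E * (H y)%:E)%E)) => //.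
- by apply/measurable_EFinP; exact: measurable_funM.
- move=> y _; rewrite /= lee_fin !normrM mulrC ler_wpM2r//.
  by rewrite (le_trans (phiC y))// ler_norm.
- exact: integrableZl.
Qed.

Lemma bounded_measurableM phi psi : bounded_measurable phi ->
  bounded_measurable psi -> bounded_measurable (fun y => phi y * psi y).
Proof.
move=> [m1 [C1 b1]] [m2 [C2 b2]]; split; first exact: measurable_funM.
by exists (C1 * C2) => y; rewrite normrM ler_pM.
Qed.

Lemma bounded_measurableD phi psi : bounded_measurable phi ->
  bounded_measurable psi -> bounded_measurable (fun y => phi y + psi y).
Proof.
move=> [m1 [C1 b1]] [m2 [C2 b2]]; split; first exact: measurable_funD.
by exists (C1 + C2) => y; rewrite (le_trans (ler_normD _ _))// lerD.
Qed.

Lemma bounded_measurable_cst (a : R) : bounded_measurable (fun=> a).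
Proof. by split => //; exists `|a|. Qed.

Lemma bounded_measurable_sum (I : Type) (s : seq I) (phi : I -> T -> R) :
  (forall i, bounded_measurable (phi i)) ->
  bounded_measurable (fun y => \sum_(i <- s) phi i y).
Proof.
move=> bphi; elim: s => [|i s IH].
  rewrite (_ : (fun y => _) = fun=> 0); first exact: bounded_measurable_cst.
  by apply/funext => y; rewrite big_nil.
rewrite (_ : (fun y => _) = fun y => phi i y + \sum_(j <- s) phi j y).
  exact: bounded_measurableD.
by apply/funext => y; rewrite big_cons.
Qed.

(** Boundedness and measurability are included so that integrals of linear combinations split
    without further integrability conditions. *)
Definition orthogonal_to phi : Prop :=
  bounded_measurable phi /\ \int[mu]_y (H y * phi y) = 0.

Lemma eq_orthogonal phi psi : phi =1 psi -> orthogonal_to phi -> orthogonal_to psi.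
Proof. by move=> /funext ->. Qed.

Lemma orthogonalD phi psi : orthogonal_to phi -> orthogonal_to psi ->
  orthogonal_to (fun y => phi y + psi y).
Proof.
move=> [b1 o1] [b2 o2]; split; first exact: bounded_measurableD.
under eq_Rintegral do rewrite mulrDr.
by rewrite RintegralD ?o1 ?o2 ?addr0//; exact: integrable_weighted.
Qed.

Lemma orthogonalZ (a : R) phi : orthogonal_to phi ->
  orthogonal_to (fun y => a * phi y).
Proof.
move=> [b1 o1]; split; first by apply: bounded_measurableM => //; exact: bounded_measurable_cst.
under eq_Rintegral do rewrite mulrCA.
by rewrite RintegralZl ?o1 ?mulr0//; exact: integrable_weighted.
Qed.

Lemma orthogonal_sum (I : Type) (s : seq I) (phi : I -> T -> R) :
  (forall i, orthogonal_to (phi i)) ->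
  orthogonal_to (fun y => \sum_(i <- s) phi i y).
Proof.
move=> ophi; elim: s => [|i s IH].
  split; last by rewrite /Rintegral integral0_eq// => y _; rewrite big_nil mulr0.
  by apply: bounded_measurable_sum => i; have [] := ophi i.
apply: (eq_orthogonal (phi := fun y => phi i y + \sum_(j <- s) phi j y)).
  by move=> y; rewrite big_cons.
exact: orthogonalD.
Qed.

End weighted_integral.

(** * Inversion in the unit sphere *)

Section inversion.
Context {R : realType} (n : nat).
Implicit Types (a c y : 'rV[R]_n).

Definition inversion a : 'rV[R]_n := (enorm a ^- 2) *: a.

Lemma enorm_inversion a : enorm (inversion a) = (enorm a)^-1.
Proof.
rewrite enormZ ger0_norm ?invr_ge0 ?exprn_ge0 ?enorm_ge0//.
have [->|a0] := eqVneq (enorm a) 0; first by rewrite mulr0 invr0.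
by field.
Qed.

Lemma measurable_inversion : measurable_fun [set: 'rV[R]_n] inversion.
Proof.
apply: measurable_rVP => i.
rewrite (_ : (fun _ => _) = fun y : 'rV[R]_n => (enorm y `^ (- 1)) ^+ 2 * y 0 i).
  apply: measurable_funM; last exact: measurable_coord.
  apply: measurable_funX.
  exact: (measurableT_comp (measurable_powR (- 1)) (@measurable_enorm R n)).
by apply/funext => y; rewrite mxE powR_inv1 ?enorm_ge0// exprVn.
Qed.

Lemma sqr_enormB a c :
  enorm (a - c) ^+ 2 = enorm a ^+ 2 - 2 * (\sum_i a 0 i * c 0 i) + enorm c ^+ 2.
Proof.
rewrite !sqr_enorm mulr_sumr -sumrN -!big_split/=; apply: eq_bigr => i _.
by rewrite !mxE; ring.
Qed.

(** Both squares are expanded by [sqr_enormB]. The formula translates closeness after inversion into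
    closeness before it, and conversely. *)
Lemma enorm_inversionB a c : 0 < enorm a -> 0 < enorm c ->
  enorm (inversion a - inversion c) = enorm (a - c) / (enorm a * enorm c).
Proof.
move=> a0 c0; apply/eqP.
rewrite -(@eqrXn2 _ 2) ?enorm_ge0//; last first.
  by rewrite divr_ge0 ?mulr_ge0 ?enorm_ge0.
rewrite exprMn exprVn !sqr_enormB !enorm_inversion.
rewrite (_ : \sum_i _ = (enorm a ^- 2) * (enorm c ^- 2) * \sum_i a 0 i * c 0 i).
  by apply/eqP; field; rewrite !gt_eqF.
by rewrite mulr_sumr; apply: eq_bigr => i _; rewrite !mxE; ring.
Qed.

(** This is why the exponents c - 2k are the right ones: a kernel p(a) |a|^(c-2k), with p of degree
    k, is |a|^c times the polynomial p in the inverted variable. *)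
Lemma mono_inversion (l : seq 'I_n) a (c : R) : 0 < enorm a ->
  enorm a `^ c * mono l (inversion a) = ker l (c - 2 * (size l)%:R) a.
Proof.
move=> a0; elim: l c => [|i l IH] c.
  by rewrite /ker /mono !big_nil mulr0 subr0 mulrC.
rewrite mono_cons mulrCA IH /ker mono_cons mxE /=.
have -> : c - 2 * (size l).+1%:R = c - 2 * (size l)%:R - 2 by rewrite -natr1; ring.
rewrite [in RHS]powRB; last by rewrite (gt_eqF a0) implybT.
by rewrite (powR_mulrn 2) ?enorm_ge0//; ring.
Qed.

End inversion.

Section unique_continuation.
Context {R : realType} (n : nat).
Local Notation lam := (@lebesgue_rV R n).

(** Division by q1^N gives A <= (q2/q1)^N B, and the right side tends to 0. *)
Lemma geometric_domination (q1 q2 A B : R) : 0 <= q2 -> q2 < q1 ->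
  (forall N, q1 ^+ N * A <= q2 ^+ N * B) -> A <= 0.
Proof.
move=> q20 q21 H; have q10 : 0 < q1 by apply: le_lt_trans q21.
have HN N : A <= (q2 / q1) ^+ N * B.
  rewrite -(ler_pM2l (exprn_gt0 N q10)); apply: le_trans (H N) _.
  by rewrite expr_div_n mulrA [q1 ^+ N * _]mulrC mulfVK// expf_eq0 gt_eqF ?andbF.
have cv : (q2 / q1) ^+ N * B @[N --> \oo] --> 0 * B.
  apply: cvgMl; apply: cvg_expr.
  by rewrite ger0_norm ?divr_ge0 ?(ltW q10)// ltr_pdivrMr ?mul1r.
rewrite mul0r in cv.
by rewrite -(cvg_lim _ cv)//; apply: limr_ge; [apply/cvg_ex; exists 0|exact: nearW].
Qed.

Variables (x0 : 'rV[R]_n) (r c : R) (r0 : 0 < r) (c0 : c < 0).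

(** Suppose g y0 > 0. The weight [H], which is g times |x0 - y|^c, is orthogonal to all polynomials
    in the inverted variable [Z], in particular to q^N. The part of this integral near y0 is at
    least p1^N [I1] with [I1] > 0, and the rest is at least -p2^N [I2] with p2 < p1; for large N the
    two cannot add up to 0. *)
Lemma moments_le0 (g : 'rV[R]_n -> R) : lam.-integrable setT (EFin \o g) ->
  continuous g -> (forall y, enorm (x0 - y) < 2 * r -> g y = 0) ->
  (forall l, conv g r l (c - 2 * (size l)%:R) x0 = 0) ->
  forall y, g y <= 0.
Proof.
move=> ig cg gx0 gl y0; rewrite leNgt; apply/negP => gy0.
have rr : 2 * r = r + r by ring.
have b2r : 2 * r <= enorm (x0 - y0).
  by rewrite leNgt; apply/negP => /gx0 H; rewrite H ltxx in gy0.
set bn := enorm (x0 - y0) in b2r.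
have bn0 : 0 < bn by apply: lt_le_trans b2r; rewrite rr addr_gt0.
pose w := inversion (x0 - y0).
(* The cut keeps [Z] bounded; [H] is zero where [Z] is replaced by 0. *)
pose Z y := cut r (x0 - y) *: inversion (x0 - y).
pose H y := g y * (cut r (x0 - y) * ker [::] c (x0 - y)).
(* [Z y] and [w] have norm at most 1/r, so |Z y - w|^2 <= (2/r)^2 = M. *)
pose M := 4 / r ^+ 2.
have M0 : 0 < M by rewrite divr_gt0 ?exprn_gt0.
(* [q] peaks at [y0]: there [q = 1], and [0 <= q < 1] elsewhere. *)
pose q y := 1 - enorm (Z y - w) ^+ 2 / M.
have sz0 : (size ([::] : seq 'I_n))%:R + c <= 0 by rewrite add0r ltW.
have iH : lam.-integrable setT (EFin \o H) := integrable_conv ig r0 x0 sz0.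
have ZE y : r <= enorm (x0 - y) -> Z y = inversion (x0 - y).
  by move=> ry; rewrite /Z cut1// scale1r.
have Z0 y : enorm (x0 - y) < r -> Z y = 0.
  by move=> ry; rewrite /Z cut0// scale0r.
have HE y : r <= enorm (x0 - y) -> H y = g y * enorm (x0 - y) `^ c.
  by move=> ry; rewrite /H cut1// /ker /mono big_nil !mul1r.
have H0 y : enorm (x0 - y) < r -> H y = 0.
  by move=> ry; rewrite /H cut0// mul0r mulr0.
have Zr y : enorm (Z y) <= r^-1.
  have [ry|ry] := ler_or_lt r (enorm (x0 - y)); last first.
    by rewrite Z0// enorm0 invr_ge0 ltW.
  by rewrite ZE// enorm_inversion lef_pV2// posrE (lt_le_trans r0).
have wr : enorm w <= r^-1.
  by rewrite enorm_inversion lef_pV2// ?posrE// (le_trans _ b2r)// rr lerDl ltW.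
have Zw y : enorm (Z y - w) ^+ 2 <= M.
  have rM : M = (r^-1 + r^-1) ^+ 2 by rewrite /M; field; rewrite gt_eqF.
  rewrite rM lerXn2r ?nnegrE ?enorm_ge0 ?addr_ge0 ?invr_ge0 ?(ltW r0)//.
  by apply: le_trans (ler_enormD _ _) _; rewrite enormN lerD.
have q0 y : 0 <= q y by rewrite subr_ge0 ler_pdivrMr ?mul1r.
have q1 y : q y <= 1.
  by rewrite gerBl divr_ge0 ?exprn_ge0 ?enorm_ge0// ltW.
have mZ : measurable_fun setT Z.
  apply: measurable_rVP => i; under eq_fun do rewrite mxE.
  apply: measurable_funM.
    exact: (measurableT_comp (measurable_cut r) (measurable_rVBl x0)).
  apply: (measurableT_comp (measurable_coord i)).
  exact: (measurableT_comp (@measurable_inversion R n) (measurable_rVBl x0)).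
have bmono l : bounded_measurable (fun y => mono l (Z y)).
  split; first exact: (measurableT_comp (measurable_mono l)).
  exists (r^-1 ^+ size l) => y; apply: le_trans (normr_mono _ _) _.
  by rewrite lerXn2r ?nnegrE ?enorm_ge0 ?invr_ge0 ?(ltW r0).
have mq : measurable_fun setT q.
  apply: measurable_funB => //; apply: measurable_funM => //.
  apply: measurable_funX; apply: measurableT_comp; first exact: measurable_enorm.
  have := measurableT_comp (measurable_affine_rV 1 (- w)) mZ.
  by congr measurable_fun; apply/funext => y /=; rewrite scale1r.
have bqN N : bounded_measurable (fun y => q y ^+ N).
  split; first exact: measurable_funX.
  by exists 1 => y; rewrite ger0_norm ?exprn_ge0// exprn_ile1.
(* A factor q is a polynomial in [Z], namely 1 - (|w|^2 + |Z|^2 - 2 Z.w)/M, so it only adds indices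
   to l; hence the induction on N for all l at once. *)
have oq N l : orthogonal_to lam H (fun y => mono l (Z y) * q y ^+ N).
  elim: N l => [|N IH] l.
    split; first exact: bounded_measurableM.
    rewrite -(gl l); apply: eq_Rintegral => y _; rewrite expr0 mulr1.
    have [ry|ry] := ler_or_lt r (enorm (x0 - y)); last first.
      by rewrite H0// cut0// !mul0r mulr0.
    by rewrite HE// ZE// cut1// mul1r -mono_inversion ?mulrA// (lt_le_trans r0).
  have o1 := orthogonalZ iH (1 - enorm w ^+ 2 / M) (IH l).
  have o2 := orthogonalZ iH (- M^-1)
    (orthogonal_sum iH (index_enum 'I_n) (fun i => IH [:: i, i & l])).
  have o3 := orthogonal_sum iH (index_enum 'I_n)
    (fun i => orthogonalZ iH (2 * w 0 i / M) (IH (i :: l))).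
  apply: eq_orthogonal (orthogonalD iH (orthogonalD iH o1 o2) o3) => y.
  rewrite [q y ^+ N.+1]exprS; move: (q y ^+ N) => Q.
  have -> : \sum_i mono [:: i, i & l] (Z y) * Q =
      (\sum_i Z y 0 i ^+ 2) * (mono l (Z y) * Q).
    by rewrite mulr_suml; apply: eq_bigr => i _; rewrite !mono_cons; ring.
  have -> : \sum_i 2 * w 0 i / M * (mono (i :: l) (Z y) * Q) =
      2 / M * (\sum_i Z y 0 i * w 0 i) * (mono l (Z y) * Q).
    by rewrite mulr_sumr mulr_suml; apply: eq_bigr => i _; rewrite !mono_cons; ring.
  by rewrite /q sqr_enormB [enorm (Z y) ^+ 2]sqr_enorm; ring.
have [eta [eta0 eta_r gpos]] : exists eta, [/\ 0 < eta, eta <= r &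
    forall y, enorm (y - y0) < eta -> g y0 / 2 < g y].
  have : \forall y \near y0, g y0 / 2 < g y.
    by apply: (cvgr_gt _ (cg y0)); rewrite ltr_pdivrMr// ltr_pMr// ltr1n.
  move=> /nbhs_ballP[e /= e0 He]; exists (Num.min e r); split.
  - by rewrite lt_min e0.
  - by rewrite ge_min lexx orbT.
  move=> y; rewrite lt_min => /andP[ye _]; apply: He; split => // i j.
  rewrite /ball/= distrC (ord1 i); apply: le_lt_trans ye.
  by have := coord_le_enorm (y - y0) j; rewrite !mxE.
(* If |Z y - w| < delta <= 1/(2 bn), then |Z y| >= 1/(2 bn), that is |x0 - y| <= 2 bn, and so |y -
   y0| = |Z y - w| |x0 - y| bn < eta. *)
pose delta := eta / (2 * bn ^+ 2).
have delta0 : 0 < delta by rewrite divr_gt0// mulr_gt0// exprn_gt0.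
have bnE : enorm w = bn^-1 by rewrite enorm_inversion.
have deltaV : delta <= bn^-1 / 2.
  rewrite /delta expr2 [2 * _]mulrC -mulrA invfM mulrCA ler_pM2l ?invr_gt0//.
  rewrite ler_pdivrMr ?mulr_gt0//.
  rewrite mulrCA mulVf// mulr1; lra.
have distE y : r <= enorm (x0 - y) ->
    enorm (Z y - w) = enorm (y - y0) / (enorm (x0 - y) * bn).
  move=> ry; rewrite ZE// enorm_inversionB//; last exact: lt_le_trans ry.
  have -> : x0 - y - (x0 - y0) = - (y - y0) by rewrite !opprB addrC addrA subrK.
  by rewrite enormN.
have near_w y : r <= enorm (x0 - y) -> enorm (Z y - w) < delta ->
    enorm (y - y0) < eta.
  move=> ry Zd; have a0 : 0 < enorm (x0 - y) by rewrite (lt_le_trans r0).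
  have : bn^-1 / 2 <= (enorm (x0 - y))^-1.
    rewrite -enorm_inversion -ZE//.
    have := ler_enormD (Z y) (w - Z y); rewrite addrCA subrr addr0 bnE.
    by rewrite -(enormN (w - Z y)) opprB; lra.
  rewrite -invfM lef_pV2 ?posrE ?mulr_gt0// => a2.
  move: Zd; rewrite distE// ltr_pdivrMr ?mulr_gt0// => /lt_le_trans; apply.
  rewrite /delta mulrAC ler_pdivrMr ?mulr_gt0 ?exprn_gt0// ler_pM2l// expr2 mulrA.
  by rewrite ler_pM2r// mulrC.
(* Conversely, |y - y0| < eta2 and |x0 - y| >= r give |Z y - w| <= eta2/(r bn) = delta/2. *)
pose eta2 := r * bn * delta / 2.
have eta20 : 0 < eta2 by apply: divr_gt0 => //; apply: mulr_gt0 => //; exact: mulr_gt0.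
have eta2eta : eta2 <= eta.
  rewrite /eta2 /delta (_ : _ / 2 = eta * (r / (4 * bn))); last by field; rewrite gt_eqF.
  rewrite ler_piMr ?(ltW eta0)// ler_pdivrMr ?mulr_gt0// mul1r; lra.
have eta2r := le_trans eta2eta eta_r.
have near_y0 y : enorm (y - y0) < eta2 ->
    [/\ r <= enorm (x0 - y), enorm (x0 - y) <= 2 * bn & enorm (Z y - w) <= delta / 2].
  move=> yy0; have ry : r <= enorm (x0 - y).
    have := ler_enormD (x0 - y) (y - y0); rewrite addrA subrK -/bn; lra.
  have a0 : 0 < enorm (x0 - y) by rewrite (lt_le_trans r0).
  split => //.
    have := ler_enormD (x0 - y0) (y0 - y); rewrite addrA subrK -/bn.
    by rewrite -(enormN (y0 - y)) opprB; lra.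
  rewrite distE// ler_pdivrMr ?mulr_gt0//; apply: (le_trans (ltW yy0)).
  rewrite /eta2 (_ : _ / 2 = delta / 2 * (r * bn)); last by ring.
  have d20 : 0 < delta / 2 by exact: divr_gt0.
  by rewrite (ler_pM2l d20) (ler_pM2r bn0).
have n10 : 0 < n.+1%:R :> R by [].
(* The Euclidean norm is at most the sum of the n coordinates, hence below eta2; n+1 also covers n =
   0. *)
pose A := box y0 (eta2 / n.+1%:R).
have mA : measurable A := @measurable_box _ _ y0 _.
have Ay y : A y -> enorm (y - y0) < eta2.
  move=> Ay; apply: le_lt_trans (enorm_le_sum _) _.
  apply: le_lt_trans (_ : n%:R * (eta2 / n.+1%:R) < _).
    rewrite mulr_natl -[X in _ *+ X]card_ord -sumr_const; apply: ler_sum => i _.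
    by rewrite !mxE ltW.
  by rewrite mulrCA gtr_pMr// ltr_pdivrMr// mul1r ltr_nat.
(* On A one has g > g(y0)/2 and |x0 - y| <= 2 bn, and c is negative. *)
pose e1 := g y0 / 2 * (2 * bn) `^ c.
have e10 : 0 < e1 by rewrite mulr_gt0 ?divr_gt0// powR_gt0// mulr_gt0.
have HA y : A y -> e1 <= H y.
  move=> /Ay yy0; have [ry a2 _] := near_y0 y yy0.
  rewrite HE// /e1; apply: ler_pM; rewrite ?powR_ge0 ?divr_ge0 ?(ltW gy0)//.
    by apply/ltW/gpos; rewrite (lt_le_trans yy0).
  by apply: powR_le_npos => //; [exact: lt_le_trans ry|exact: ltW].
have bA : bounded_measurable (\1_A : 'rV[R]_n -> R).
  split; first exact: measurable_indic.
  by exists 1 => y; rewrite indicE; case: (_ \in _); rewrite ?normr1 ?normr0.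
pose I1 := \int[lam]_y (H y * \1_A y).
have iHA := integrable_weighted iH bA.
have I10 : 0 < I1.
  apply: fine_gt0; rewrite ltey_eq integrable_fin_num ?orTb// andbT.
  apply: (@lt_le_trans _ _ (e1%:E * lam A)%E).
    by rewrite mule_gt0 ?lte_fin// box_gt0// divr_gt0.
  rewrite -[A in lam A]setIT -integral_indic// -ge0_integralZl_EFin ?(ltW e10)//; last first.
    by apply/measurable_EFinP; exact: measurable_indic.
  apply: ge0_le_integral => //.
  - by move=> y _; rewrite mule_ge0// lee_fin ltW.
  - by apply/measurable_EFinP; apply: measurable_funM => //; exact: measurable_indic.
  - by have /integrableP[] := iHA.
  - move=> y _; rewrite -EFinM lee_fin indicE; case: (boolP (y \in A)) => [/set_mem yA|_].
      by rewrite !mulr1 HA.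
    by rewrite !mulr0.
pose I2 := \int[lam]_y `|H y|.
have iHn : lam.-integrable setT (EFin \o (fun y => `|H y|)).
  rewrite (_ : _ \o _ = fun y => `|(H y)%:E|%E)//; exact: integrable_abse.
(* p1 bounds q from below on A, and p2 bounds q from above where |Z y - w| >= delta. *)
pose p1 := 1 - (delta / 2) ^+ 2 / M.
pose p2 := 1 - delta ^+ 2 / M.
have p20 : 0 <= p2.
  rewrite subr_ge0 ler_pdivrMr// mul1r.
  have dr : delta <= r^-1.
    by apply: le_trans wr;
      rewrite bnE (le_trans deltaV)// ler_pdivrMr// ler_peMr ?invr_ge0 ?(ltW bn0)// ler1n.
  apply: (@le_trans _ _ (r^-1 ^+ 2)).
    by rewrite lerXn2r ?nnegrE ?(ltW delta0) ?invr_ge0 ?(ltW r0).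
  by rewrite /M exprVn ler_peMl ?invr_ge0 ?exprn_ge0 ?(ltW r0)// ler1n.
have p21 : p2 < p1.
  have dd : delta / 2 < delta by rewrite ltr_pdivrMr// ltr_pMr// ltr1n.
  have d20 : 0 <= delta / 2 := divr_ge0 (ltW delta0) (ler0n R 2).
  by rewrite ltrD2l ltrN2 ltr_pM2r ?invr_gt0// ltrXn2r.
suff : I1 <= 0 by rewrite leNgt I10.
apply: (geometric_domination p20 p21 (B := I2)) => N.
rewrite -subr_le0 -RintegralZl// -RintegralZl// -RintegralB//; last 2 first.
- rewrite (_ : _ \o _ = fun y => ((p1 ^+ N)%:E * (H y * \1_A y)%:E)%E)//; exact: integrableZl.
- rewrite (_ : _ \o _ = fun y => ((p2 ^+ N)%:E * `|H y|%:E)%E)//; exact: integrableZl.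
have [_ oN] := oq N [::].
(* Pointwise comparison with H q^N, whose integral is 0. On A, q >= p1. Off A: below radius r, H =
   0; where |Z y - w| >= delta, q <= p2; in the remaining region g > 0, so H q^N >= 0. *)
rewrite -oN; apply: le_Rintegral => //.
- rewrite (_ : _ \o _ = fun y => ((p1 ^+ N)%:E * (H y * \1_A y)%:E - (p2 ^+ N)%:E * `|H y|%:E)%E)//.
  by apply: integrableB => //; exact: integrableZl.
- exact: integrable_weighted (proj1 (oq N [::])).
have MV0 : 0 < M^-1 by rewrite invr_gt0.
move=> y _; rewrite /mono big_nil mul1r.
have p2H : 0 <= p2 ^+ N * `|H y| by rewrite mulr_ge0// exprn_ge0.
rewrite indicE; case: (boolP (y \in A)) => [/set_mem yA|_].
  have [_ _ Zd] := near_y0 y (Ay y yA).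
  rewrite mulr1 lerBlDr; apply: (le_trans _ (_ : H y * q y ^+ N <= _)); last by rewrite lerDl.
  have Hy0 := lt_le_trans e10 (HA y yA).
  rewrite mulrC (ler_pM2l Hy0).
  have p10 : 0 <= p1 by rewrite (le_trans p20)// ltW.
  rewrite lerXn2r ?nnegrE// lerD2l lerN2 (ler_pM2r MV0).
  have d20 : 0 <= delta / 2 := divr_ge0 (ltW delta0) (ler0n R 2).
  by rewrite lerXn2r ?nnegrE ?enorm_ge0.
rewrite !mulr0 sub0r.
have [ry|ry] := ler_or_lt r (enorm (x0 - y)); last by rewrite H0// normr0 mulr0 mul0r oppr0.
have [dZ|Zd] := ler_or_lt delta (enorm (Z y - w)).
  rewrite lerNl; apply: le_trans (ler_norm _) _.
  rewrite normrN normrM mulrC ler_wpM2r// ger0_norm ?exprn_ge0//.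
  rewrite lerXn2r ?nnegrE// lerD2l lerN2 (ler_pM2r MV0).
  by rewrite lerXn2r ?nnegrE ?enorm_ge0// ltW.
apply: (@le_trans _ _ 0); first by rewrite oppr_le0.
rewrite mulr_ge0 ?exprn_ge0// HE// mulr_ge0 ?powR_ge0//.
by apply: ltW; apply: lt_trans (gpos y (near_w y ry Zd)); rewrite divr_gt0.
Qed.

Lemma unique_continuation_at (g : 'rV[R]_n -> R) : lam.-integrable setT (EFin \o g) ->
  continuous g -> (forall y, enorm (x0 - y) < 2 * r -> g y = 0) ->
  (forall l, conv g r l (c - 2 * (size l)%:R) x0 = 0) ->
  forall y, g y = 0.
Proof.
move=> ig cg gx0 gl y; apply/eqP; rewrite eq_le (moments_le0 ig)//=.
rewrite -oppr_le0; apply: (@moments_le0 (fun y => - g y)).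
- rewrite (_ : _ \o _ = fun y => (- (g y)%:E)%E)//; exact: integrableN.
- by move=> z; apply: (@cvgN _ _ _ _ _ g _ (cg z)).
- by move=> z /gx0 ->; rewrite oppr0.
move=> l; rewrite -[RHS](mulr0 (-1)) -[X in _ = _ * X](gl l) /conv -RintegralZl//.
  by apply: eq_Rintegral => z _; rewrite mulNr mulN1r.
apply: integrable_conv => //.
have l0 : 0 <= (size l)%:R :> R by [].
rewrite mulr_natl mulr2n opprD addrCA addNKr.
by rewrite subr_le0 (le_trans (ltW c0)).
Qed.

End unique_continuation.

Lemma unique_continuation {R : realType} n (V E : set 'rV[R]_n)
    (g : 'rV[R]_n -> R) (r c : R) :
  measurable V -> E `<=` V -> ~ (lebesgue_rV n).-negligible E -> 0 < r ->
  c < 0 -> c + n%:R < 2 ->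
  (lebesgue_rV n).-integrable setT (EFin \o g) -> continuous g ->
  (forall x y, V x -> enorm (x - y) < 2 * r -> g y = 0) ->
  vanishes E (conv g r [::] c) -> forall y, g y = 0.
Proof.
move=> mV EV nE r0 c0 cn ig cg gV vc.
have [x Ex x0] := vanishes_exists nE (vanishes_conv_ladder mV EV ig r0 gV c0 cn vc).
apply: (@unique_continuation_at _ _ x r c) => // y.
by apply: gV; exact: EV.
Qed.

(** * Contractions of a symmetric tensor *)

Section derivation.
Context {R : realType} (n : nat).
Local Notation lam := (@lebesgue_rV R n).
Variables (V E : set 'rV[R]_n) (mV : measurable V) (EV : E `<=` V).

(** Measurability of both functions, required by [vanishes_derive], travels with the derivative, so
    that linear combinations preserve the whole bundle. *)
Definition derives (i : 'I_n) (u v : 'rV[R]_n -> R) : Prop :=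
  [/\ measurable_fun setT u, measurable_fun setT v & forall x, V x ->
    is_derive (0 : R) 1 (fun h : R => u (x + h *: delta_mx 0 i)) (v x)].

Lemma derives_vanishes i u v : derives i u v -> vanishes E u -> vanishes E v.
Proof. by move=> [mu mv duv]; exact: (vanishes_derive mV EV). Qed.

Lemma derivesD i u v u' v' : derives i u v -> derives i u' v' ->
  derives i (fun x => u x + u' x) (fun x => v x + v' x).
Proof.
move=> [m1 m2 d] [m3 m4 d']; split; [exact: measurable_funD..|move=> x Vx].
by have := is_deriveD (d x Vx) (d' x Vx).
Qed.

Lemma derivesZ i (a : R) u v : derives i u v ->
  derives i (fun x => a * u x) (fun x => a * v x).
Proof.
move=> [m1 m2 d]; split; [exact: measurable_funM..|move=> x Vx].
by have := @is_deriveZ R R R _ a 0 1 _ (d x Vx).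
Qed.

Lemma derives_sum i (I : Type) (s : seq I) (u v : I -> 'rV[R]_n -> R) :
  (forall j, derives i (u j) (v j)) ->
  derives i (fun x => \sum_(j <- s) u j x) (fun x => \sum_(j <- s) v j x).
Proof.
move=> duv; elim: s => [|j s IH].
  have z (w : I -> 'rV[R]_n -> R) : (fun x => \sum_(j <- [::]) w j x) = cst 0.
    by apply/funext => x; rewrite big_nil.
  rewrite !z.
  by split => // x _; exact: (@is_derive_cst R R R 0 0 1).
have z (w : I -> 'rV[R]_n -> R) : (fun x => \sum_(k <- j :: s) w k x) =
    (fun x => w j x + \sum_(k <- s) w k x).
  by apply/funext => x; rewrite big_cons.
by rewrite !z; exact: derivesD.
Qed.

Lemma eq_derives i u v u' v' : derives i u v -> u =1 u' -> v =1 v' -> derives i u' v'.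
Proof. by move=> d /funext <- /funext <-. Qed.

End derivation.

Section tensor.
Context {R : realType} (n : nat).
Local Notation lam := (@lebesgue_rV R n).
Variables (V E : set 'rV[R]_n) (mV : measurable V) (EV : E `<=` V).
Hypothesis nE : ~ lam.-negligible E.
Variables (f : 'I_n -> 'I_n -> 'rV[R]_n -> R) (r : R).
Hypotheses (fC : forall j k, f j k = f k j) (r0 : 0 < r).
Hypothesis intf : forall j k, lam.-integrable setT (EFin \o f j k).
Hypothesis cf : forall j k, continuous (f j k).
Hypothesis fV : forall j k x y, V x -> enorm (x - y) < 2 * r -> f j k y = 0.
Local Notation vn := (vanishes E).
Local Notation drv := (derives V).
Local Notation J j k l b := (conv (f j k) r l b).

(* Potentials of [f] with kernel [y^l |y|^b], fully, once and never contracted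
   with [y]. *)
Definition full_contraction (l : seq 'I_n) (b : R) (x : 'rV[R]_n) : R :=
  \sum_j \sum_k J j k [:: j, k & l] b x.

Definition half_contraction (l : seq 'I_n) (p : 'I_n) (b : R) (x : 'rV[R]_n) : R :=
  \sum_k J p k (k :: l) b x.

Local Notation T := full_contraction.
Local Notation W := half_contraction.

(** Product rule for y_j y^l: a derivative removes either the factor y_j or one from y^l. The prefix
    [p] lets the rule be applied below indices already treated. *)
Lemma count_conv_rem_cons g (p l : seq 'I_n) (i j : 'I_n) (b : R) x :
  (count_mem i (j :: l))%:R * conv g r (p ++ rem i (j :: l)) b x =
  (j == i)%:R * conv g r (p ++ l) b x +
  (count_mem i l)%:R * conv g r (p ++ j :: rem i l) b x.
Proof.
rewrite /=; have [->|ji] := eqVneq j i; last by rewrite add0n mul0r add0r.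
rewrite natrD mulrDl; congr (_ + _).
have [il|il] := boolP (i \in l); last by rewrite (count_memPn il) !mul0r.
by congr (_ * _); apply: conv_perm; rewrite perm_cat2l perm_to_rem.
Qed.

Lemma derives_conv j k i l b : (size l)%:R + b <= 0 ->
  drv i (J j k l b)
    (fun x => (count_mem i l)%:R * J j k (rem i l) b x + b * J j k (i :: l) (b - 2) x).
Proof.
move=> lb; split.
- exact: measurable_conv.
- by apply: measurable_funD; apply: measurable_funM => //; exact: measurable_conv.
- by move=> x Vx; apply: is_derive_conv => // y; exact: fV.
Qed.

(** The term J p i l b comes from differentiating the contracted factor y_k, which selects k = i. *)
Lemma derives_half i l p b : (size l)%:R + 1 + b <= 0 ->
  drv i (W l p b) (fun x => J p i l b x +
    (count_mem i l)%:R * W (rem i l) p b x + b * W (i :: l) p (b - 2) x).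
Proof.
move=> lb; have sb k : (size (k :: l))%:R + b <= 0 by rewrite /= -natr1.
apply: (eq_derives (derives_sum (index_enum 'I_n)
  (fun k => derives_conv p k i (sb k)))) => // x.
rewrite big_split/= !mulr_sumr; congr (_ + _); last first.
  by apply: eq_bigr => k _; congr (_ * _); apply: conv_perm; rewrite (perm_catCA [:: i] [:: k]).
under eq_bigr do rewrite (count_conv_rem_cons _ [::]).
rewrite big_split/=; congr (_ + _).
rewrite (bigD1 i)//= eqxx mul1r big1 ?addr0// => k /negbTE ->.
by rewrite mul0r.
Qed.

(** Either contracted factor, y_j or y_k, can be differentiated; by the symmetry of f both give W l
    i b, hence the factor 2. *)
Lemma derives_full i l b : (size l)%:R + 2 + b <= 0 ->
  drv i (T l b) (fun x => 2 * W l i b x +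
    (count_mem i l)%:R * T (rem i l) b x + b * T (i :: l) (b - 2) x).
Proof.
move=> lb; have sb j k : (size [:: j, k & l])%:R + b <= 0.
  by rewrite /= -!natr1 -[_ + 1 + 1]addrA.
apply: (eq_derives (derives_sum (index_enum 'I_n) (fun j =>
  derives_sum (index_enum 'I_n) (fun k => derives_conv j k i (sb j k))))) => // x.
have cnt : \sum_j \sum_k (count_mem i [:: j, k & l])%:R * J j k (rem i [:: j, k & l]) b x =
    2 * W l i b x + (count_mem i l)%:R * T (rem i l) b x.
  transitivity (\sum_j \sum_k ((j == i)%:R * J j k (k :: l) b x +
      ((k == i)%:R * J j k (j :: l) b x + (count_mem i l)%:R * J j k [:: j, k & rem i l] b x))).
    apply: eq_bigr => j _; apply: eq_bigr => k _.
    by rewrite (count_conv_rem_cons _ [::]) (count_conv_rem_cons _ [:: j]).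
  under eq_bigr do rewrite big_split big_split /=.
  rewrite big_split big_split /= addrA; congr (_ + _); last first.
    by rewrite mulr_sumr; apply: eq_bigr => j _; rewrite mulr_sumr.
  rewrite mulrDl mul1r; congr (_ + _).
    rewrite (bigD1 i)//= [X in _ + X]big1 ?addr0 => [|j /negbTE ji].
      by apply: eq_bigr => k _; rewrite eqxx mul1r.
    by rewrite big1// => k _; rewrite ji mul0r.
  apply: eq_bigr => j _.
  rewrite (bigD1 i)//= eqxx mul1r big1 ?addr0 ?(fC j i)// => k /negbTE ->.
  by rewrite mul0r.
rewrite -cnt; under eq_bigr do rewrite big_split.
rewrite big_split; congr (_ + _).
rewrite mulr_sumr; apply: eq_bigr => j _; rewrite mulr_sumr; apply: eq_bigr => k _.
by congr (_ * _); apply: conv_perm; rewrite (perm_catCA [:: i] [:: j; k]).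
Qed.

Lemma full_perm l l' b x : perm_eq l l' -> T l b x = T l' b x.
Proof.
move=> ll'; apply: eq_bigr => j _; apply: eq_bigr => k _.
by apply: conv_perm; rewrite !perm_cons.
Qed.

Lemma full_contract l b x : (size l)%:R + b + 4 <= 0 ->
  \sum_m T [:: m, m & l] b x = T l (b + 2) x.
Proof.
move=> lb; rewrite exchange_big; apply: eq_bigr => j _.
rewrite exchange_big; apply: eq_bigr => k _.
rewrite -conv_contract//; last by rewrite /= -!natr1; lra.
apply: eq_bigr => m _; apply: conv_perm.
by rewrite (perm_catCA [:: j; k] [:: m; m] l).
Qed.

Lemma half_contract l b x : \sum_m W (m :: l) m b x = T l b x.
Proof.
apply: eq_bigr => j _; apply: eq_bigr => k _; apply: conv_perm.
by rewrite (perm_catCA [:: k] [:: j] l).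
Qed.

Lemma sum_count_half (l m : 'I_n) b x :
  \sum_i (count_mem i [:: l; m])%:R * W (rem i [:: l; m]) i b x =
  W [:: m] l b x + W [:: l] m b x.
Proof.
have E1 i : (count_mem i [:: l; m])%:R * W (rem i [:: l; m]) i b x =
    (l == i)%:R * W [:: m] i b x + (m == i)%:R * W [:: l] i b x.
  rewrite !mulr_sumr -big_split/=; apply: eq_bigr => k _.
  rewrite (count_conv_rem_cons _ [:: k] [:: m]) (count_conv_rem_cons _ [:: k; l] [::]) /=.
  rewrite mul0r addr0; congr (_ + _ * _); apply: conv_perm.
under eq_bigr do rewrite E1.
rewrite big_split/=; congr (_ + _).
  rewrite (bigD1 l)//= eqxx mul1r big1 ?addr0// => i il.
  by rewrite eq_sym (negbTE il) mul0r.
rewrite (bigD1 m)//= eqxx mul1r big1 ?addr0// => i il.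
by rewrite eq_sym (negbTE il) mul0r.
Qed.

Lemma sum_count_full (l : seq 'I_n) b x :
  \sum_i (count_mem i (i :: l))%:R * T (rem i (i :: l)) b x =
  (n%:R + (size l)%:R) * T l b x.
Proof.
under eq_bigr do rewrite /= eqxx natrD.
rewrite -mulr_suml big_split/= sumr_const card_ord.
rewrite -natr_sum; congr ((_ + _%:R) * _).
elim: l => [|m l IH] /=; first by rewrite big1.
rewrite big_split/= IH (bigD1 m)//= eqxx big1 ?addn0// => i im.
by rewrite eq_sym (negbTE im).
Qed.

(** Euler's rule: the kernel y_j y_k y^l |y|^b has degree 2 + |l| + b, so its product with y_m has,
    as divergence in m, n + 2 + |l| + b times the kernel. *)
Lemma sum_derivative_full l b x : (size l)%:R + b + 2 <= 0 ->
  \sum_m (2 * W (m :: l) m b x + (count_mem m (m :: l))%:R * T (rem m (m :: l)) b x +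
    b * T [:: m, m & l] (b - 2) x) = (2 + (n%:R + (size l)%:R) + b) * T l b x.
Proof.
move=> lb; transitivity (\sum_m 2 * W (m :: l) m b x +
    \sum_m (count_mem m (m :: l))%:R * T (rem m (m :: l)) b x +
    \sum_m b * T [:: m, m & l] (b - 2) x); first by rewrite !big_split.
transitivity (2 * T l b x + (n%:R + (size l)%:R) * T l b x + b * T l b x).
  congr (_ + _ + _); [|exact: sum_count_full|].
    by rewrite -mulr_sumr half_contract.
  by rewrite -mulr_sumr full_contract ?subrK//; lra.
by rewrite -!mulrDl.
Qed.

Lemma sum_conv_trace (l : seq 'I_n) (a : R) x : (size l)%:R + a <= 0 ->
  \sum_p J p p l a x = conv (fun y => \sum_p f p p y) r l a x.
Proof.
move=> la; rewrite /conv -Rintegral_sum//.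
  by apply: eq_Rintegral => y _; rewrite mulr_suml.
by move=> p; exact: integrable_conv.
Qed.

(** Used with c = 2s-n-2, for which the last hypothesis expresses the vanishing of A^2 f. Each
    derivative of a vanishing potential is a linear relation between potentials, solved for one new
    unknown at a time; the assumptions on c keep its coefficient nonzero. *)
Lemma tensor_unique_continuation (c : R) : c + 2 <= 0 -> c + n%:R < 0 ->
  c + n%:R + 1 != 0 -> (forall l m, vn (T [:: l; m] (c - 2))) ->
  forall j k y, f j k y = 0.
Proof.
move=> c2 nc0 nc1 T2.
have [b bE] : exists b, b = c - 2 by exists (c - 2).
rewrite -bE in T2.
have c0 : c < 0 by lra.
have b0 : b < 0 by lra.
have c0' : c != 0 by rewrite lt_eqF.
have b0' : b != 0 by rewrite lt_eqF.
have bc : b + 2 = c by rewrite bE; ring.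
have bb : b - 2 + 2 = b by ring.
have nb0 : 2 + n%:R + b != 0 by rewrite lt_eqF//; lra.
have nb1 : 2 + (n%:R + 1) + b != 0.
  by move: nc1; congr (_ != 0); rewrite bE; ring.
(* Contracting l with m replaces y_l y_m |y|^b by |y|^(b+2) = |y|^c. *)
have T0c : vn (T [::] c).
  have := vanishes_sum (index_enum 'I_n) (fun l => T2 l l).
  apply: eq_vanishes => x _; rewrite full_contract ?bc//=; lra.
(* Divergence of T [:: m; l] b over m, with coefficient c+n+1. *)
have T1 (l : 'I_n) : vn (T [:: l] b).
  have sb (m : 'I_n) : (size [:: m; l])%:R + 2 + b <= 0 by rewrite /=; lra.
  have sb2 : (size [:: l])%:R + b + 2 <= 0 by rewrite /=; lra.
  have := vanishes_sum (index_enum 'I_n) (fun m =>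
    derives_vanishes mV EV (derives_full m (sb m)) (T2 m l)).
  move=> /(vanishesZ (2 + (n%:R + 1) + b)^-1); apply: eq_vanishes => x _.
  by rewrite sum_derivative_full//= mulrA mulVf ?mul1r.
(* A second divergence, with coefficient c+n. *)
have T0 : vn (T [::] b).
  have sb (m : 'I_n) : (size [:: m])%:R + 2 + b <= 0 by rewrite /=; lra.
  have sb2 : (size ([::] : seq 'I_n))%:R + b + 2 <= 0 by rewrite /=; lra.
  have := vanishes_sum (index_enum 'I_n) (fun m =>
    derives_vanishes mV EV (derives_full m (sb m)) (T1 m)).
  move=> /(vanishesZ (2 + n%:R + b)^-1); apply: eq_vanishes => x _.
  by rewrite sum_derivative_full//= addr0 mulrA mulVf ?mul1r.
have W0 (l : 'I_n) : vn (W [::] l c).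
  have sb : (size ([::] : seq 'I_n))%:R + 2 + c <= 0 by rewrite /=; lra.
  have := derives_vanishes mV EV (derives_full l sb) T0c.
  move=> /(vanishesD (vanishesZ (- c) (T1 l)))/(vanishesZ 2^-1).
  apply: eq_vanishes => x _; rewrite /= mul0r addr0 -bE.
  by rewrite mulNr addrC addrK mulrA mulVf ?mul1r.
have FW (p i : 'I_n) : vn (fun x => J p i [::] c x + c * W [:: i] p b x).
  have sb : (size ([::] : seq 'I_n))%:R + 1 + c <= 0 by rewrite /=; lra.
  have := derives_vanishes mV EV (derives_half i p sb) (W0 p).
  by apply: eq_vanishes => x _; rewrite /= mul0r addr0 -bE.
have trace0 y : \sum_p f p p y = 0.
  move: y; apply: (@unique_continuation _ _ V E _ r c) => //; first by lra.
  - rewrite [X in integrable _ _ X](_ : _ = fun y => (\sum_p (f p p y)%:E)%E).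
      by apply: integrable_sum => // p _; exact: intf.
    by apply/funext => y /=; rewrite sumEFin.
  - apply: continuous_big; first exact: add_continuous.
    by move=> p _; exact: cf.
  - by move=> x y Vx xy; rewrite big1// => p _; exact: (fV _ _ Vx xy).
  (* Summed over p = i, [FW] is the potential of the trace plus c T [::] b, and [T0] removes the
     second term. *)
  have := vanishes_sum (index_enum 'I_n) (fun p => FW p p).
  move=> /(vanishesD (vanishesZ (- c) T0)); apply: eq_vanishes => x _.
  rewrite big_split/= sum_conv_trace/=; last by lra.
  by rewrite -mulr_sumr half_contract addrCA mulNr addNr addr0.
have trJ0 l x : (size l)%:R + b <= 0 -> \sum_p J p p l b x = 0.
  move=> lb; rewrite sum_conv_trace// /conv.
  rewrite /Rintegral integral0_eq// => y _.
  by rewrite (_ : \sum_p _ = 0) ?mul0r//; exact: trace0.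
have WT (l m : 'I_n) : vn (fun x => 2 * W [:: l] m b x + b * T [:: m; l] (b - 2) x).
  have sb : (size [:: l])%:R + 2 + b <= 0 by rewrite /=; lra.
  have := derives_vanishes mV EV (derives_full m sb) (T1 l).
  move=> /(vanishesD (vanishesZ (- (l == m)%:R) T0)); apply: eq_vanishes => x _.
  rewrite /= addn0; case: (l == m); last first.
    by rewrite mulr0n oppr0 !mul0r add0r addr0.
  by rewrite (_ : true%:R = 1 :> R)// mulN1r mul1r -[X in _ + X]addrA addrCA addKr.
have U (l m i : 'I_n) :
    vn (fun x => 2 * W [:: l; m] i b x + b * T [:: i; l; m] (b - 2) x).
  have sb : (size [:: l; m])%:R + 2 + b <= 0 by rewrite /=; lra.
  have rl : vn (fun x => (count_mem i [:: l; m])%:R * T (rem i [:: l; m]) b x).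
    apply: (@eq_vanishes _ _ _ (fun x => (l == i)%:R * T [:: m] b x + (m == i)%:R * T [:: l] b x)).
      move=> x _; rewrite /=; have [->|_] := eqVneq l i; have [->|_] := eqVneq m i.
      - by rewrite -mulrDl -natrD.
      - by rewrite !mul0r !addr0.
      - by rewrite !mul0r add0r.
      - by rewrite !mul0r addr0.
    exact: (vanishesD (vanishesZ _ (T1 m)) (vanishesZ _ (T1 l))).
  have := derives_vanishes mV EV (derives_full i sb) (T2 l m).
  move=> /(vanishesD (vanishesZ (-1) rl)); apply: eq_vanishes => x _.
  by ring.
(* Divergence of [U] over i. It contains the potential of the trace, now zero, and 2 (W [:: l] m b +
   W [:: m] l b + b T [:: l; m] (b-2)), which is the sum of the two relations [WT]. What remains is
   T [:: l; m] (b-2) with coefficient b(2+n+b) = b(c+n). *)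
have T3 (l m : 'I_n) : vn (T [:: l; m] (b - 2)).
  have sW : (size [:: l; m])%:R + 1 + b <= 0 by rewrite /=; lra.
  have sT (i : 'I_n) : (size [:: i; l; m])%:R + 2 + (b - 2) <= 0 by rewrite /=; lra.
  have dU i := derives_vanishes mV EV (derivesD (derivesZ 2 (derives_half i i sW))
    (derivesZ b (derives_full i (sT i)))) (U l m i).
  have := vanishesD (vanishes_sum (index_enum 'I_n) dU)
    (vanishesZ (- 1) (vanishesD (WT l m) (WT m l))).
  move=> /(vanishesZ (b * (2 + n%:R + b))^-1); apply: eq_vanishes => x _.
  have sl : (size [:: l; m])%:R + b <= 0 by rewrite /=; lra.
  have sl2 : (size [:: l; m])%:R + (b - 2) + 2 <= 0 by rewrite /=; lra.
  rewrite big_split -!mulr_sumr sum_derivative_full//.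
  have -> : \sum_i (J i i [:: l; m] b x +
      (count_mem i [:: l; m])%:R * W (rem i [:: l; m]) i b x + b * W [:: i; l; m] i (b - 2) x) =
      W [:: m] l b x + W [:: l] m b x + b * T [:: l; m] (b - 2) x.
    transitivity (\sum_i J i i [:: l; m] b x +
      \sum_i (count_mem i [:: l; m])%:R * W (rem i [:: l; m]) i b x +
      \sum_i b * W [:: i; l; m] i (b - 2) x); first by rewrite !big_split.
    by rewrite trJ0// add0r sum_count_half -mulr_sumr half_contract.
  rewrite (full_perm (l := [:: m; l]) (l' := [:: l; m])); last first.
    by rewrite (perm_catC [:: m] [:: l]).
  rewrite [size _]/=; move: (W [:: m] l b x) (W [:: l] m b x) (T [:: l; m] (b - 2) x) => w1 w2 t.
  rewrite [X in _ * X](_ : _ = b * (2 + n%:R + b) * t); last by rewrite /=; ring.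
  by rewrite mulKf// mulf_neq0.
move=> p i; apply: (@unique_continuation _ _ V E _ r c) => //; first by lra.
  by move=> x y Vx xy; exact: (fV _ _ Vx xy).
(* Eliminating W [:: i] p b between [FW] and [WT], with [T3] for the remaining term, isolates the
   potential of f p i. *)
have := vanishesD (FW p i) (vanishesZ (- c / 2) (vanishesD (WT i p) (vanishesZ (- b) (T3 p i)))).
by apply: eq_vanishes => x _; field.
Qed.

End tensor.

(** * The Gamma function *)

Section gamma.
Context {R : realType}.
Local Notation leb := (@lebesgue_measure R).

Lemma measurable_powR_cst (p : R) (D : set R) : measurable_fun D (fun t : R => (t `^ p)%:E).
Proof.
apply/measurable_EFinP; apply: (@measurable_funS _ _ _ _ setT) => //.
Qed.

Lemma integral_powR_itv (p r : R) : p < 1 -> 0 < r -> r < 1 ->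
  (\int[leb]_(t in `[r, 1%R]) (t `^ (- p))%:E = ((1 - p)^-1 * (1 - r `^ (1 - p)))%:E)%E.
Proof.
move=> p1 r0 r1; pose F (t : R) := (1 - p)^-1 * t `^ (1 - p).
have dF (x : R) : 0 < x -> is_derive x 1 F (x `^ (- p)).
  by move=> x0; apply: is_derive_powR_primitive => //; rewrite lt_eqF.
have cF (x : R) : 0 < x -> {for x, continuous F}.
  move=> x0; apply: differentiable_continuous.
  by apply/derivable1_diffP; have [] := dF x x0.
have cont (x : R) : 0 < x -> {for x, continuous (fun t : R => t `^ (- p))}.
  move=> x0; apply: differentiable_continuous; apply/derivable1_diffP.
  by apply: derivable_powR; rewrite in_itv/= andbT.
rewrite (@continuous_FTC2 _ _ F)//.
- by rewrite -EFinB /F powR1 -mulrBr.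
- apply: continuous_in_subspaceT => x; rewrite inE/= in_itv/= => /andP[rx _].
  by apply: cont; rewrite (lt_le_trans r0).
- split.
  + by move=> x /[!in_itv]/= /andP[rx _]; have [] := dF x (lt_trans r0 rx).
  + by apply: cvg_at_right_filter; exact: cF.
  + by apply: cvg_at_left_filter; exact: cF.
- move=> x /[!in_itv]/= /andP[rx _]; rewrite derive1E.
  by have [_ ->] := dF x (lt_trans r0 rx).
Qed.

Lemma integral_powR_near0 (p : R) : p < 1 ->
  (\int[leb]_(t in `]0%R, 1%R]) (t `^ (- p))%:E < +oo)%E.
Proof.
(* [k.+2] keeps the left end strictly below 1; the integrals over these intervals are bounded by
   1/(1-p). *)
move=> p1; pose I k : set R := `[k.+2%:R^-1, 1]%classic.
have IE : \bigcup_k I k = `]0, 1]%classic.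
  apply/seteqP; split => [t [k _]|t]; rewrite /I/= !in_itv/=.
    by move=> /andP[kt ->]; rewrite andbT (lt_le_trans _ kt)// invr_gt0.
  move=> /andP[t0 t1]; exists (Num.truncn t^-1) => //=.
  rewrite in_itv/= t1 andbT invf_ple ?posrE//.
  have ti : 0 <= t^-1 by rewrite invr_ge0 ltW.
  have /andP[_ /ltW/le_trans] := truncn_itv ti.
  by apply; rewrite ler_nat.
rewrite -IE; apply: (@le_lt_trans _ _ ((1 - p)^-1)%:E); last exact: ltry.
have ndI : nondecreasing_seq I.
  move=> a b ab; apply/subsetPset => t; rewrite /I/= !in_itv/= => /andP[at_ ->].
  rewrite andbT (le_trans _ at_)// lef_pV2 ?posrE// ler_nat.
  by rewrite !ltnS.
have mI i : @measurable _ (measurableTypeR R) (I i) by exact: measurable_itv.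
have mf i : @measurable_fun _ _ (measurableTypeR R) _ (I i) (fun t : R => (t `^ (- p))%:E).
  exact: measurable_powR_cst.
have cvI := @ge0_nondecreasing_set_cvg_integral _ (measurableTypeR R) R I _ leb ndI mI mf
  (fun _ x _ => powR_ge0 _ _).
apply: (cvge_to_le cvI); apply: nearW => k.
rewrite integral_powR_itv//; last by rewrite invf_lt1// ltr1n.
rewrite lee_fin ler_piMr ?invr_ge0 ?subr_ge0 ?(ltW p1)//.
Qed.

(** From exp t >= t^N / N! for an integer N >= a + 1. *)
Lemma powR_expRN_le (a : R) : exists2 C : R, 0 <= C &
  forall t, 1 <= t -> t `^ (a - 1) * expR (- t) <= C * t `^ (- 2).
Proof.
pose N := (Num.truncn `|a|).+2.
have aN : a - 1 <= N%:R + - 2.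
  have /andP[_ h] := truncn_itv (normr_ge0 a).
  have := le_lt_trans (ler_norm a) h; rewrite /N -!natr1; lra.
exists (N`!%:R) => // t t1; have t0 : 0 < t by rewrite (lt_le_trans _ t1).
have e1 : t ^+ N / N`!%:R <= expR t.
  by apply: le_trans (expR_ge1Dxn N.-1 (ltW t0)); rewrite lerDr.
rewrite expRN ler_pdivrMr ?expR_gt0//.
apply: (@le_trans _ _ (t `^ (N%:R + - 2))); first by rewrite ler_powR.
rewrite powRD; last by rewrite (gt_eqF t0) implybT.
rewrite powR_mulrn ?(ltW t0)// [leRHS]mulrAC ler_wpM2r ?powR_ge0//.
by rewrite mulrC -ler_pdivrMr ?ltr0n ?fact_gt0.
Qed.

(** [Gamma] is the [fine] part of an extended integral, so an infinite value would read as 0: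
    finiteness has to be proved along with positivity. The integrand is at most t^(a-1) up to 1 and
    at most C t^(-2) beyond. *)
Lemma Gamma_gt0 (a : R) : 0 < a -> 0 < Gamma a.
Proof.
move=> a0; pose F (t : R) := (t `^ (a - 1) * expR (- t))%:E.
have F0 t : (0 <= F t)%E by rewrite lee_fin mulr_ge0 ?powR_ge0 ?expR_ge0.
have mF (D : set (measurableTypeR R)) : measurable_fun D F.
  apply/measurable_EFinP; apply: measurable_funM.
    by apply/measurable_EFinP; exact: measurable_powR_cst.
  apply: (@measurable_funS _ _ _ _ setT) => //.
  by apply: measurableT_comp => //; exact: measurable_funN.
rewrite /Gamma /Rintegral fine_gt0//; apply/andP; split.
  (* On [1,2], t^(a-1) >= t^(-1) >= 1/2 because a > 0. *)
  apply: (@lt_le_trans _ _ (\int[leb]_(t in `[1%R, 2%R]) (2^-1 * expR (- 2))%:E)%E).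
    rewrite (@integral_cst _ _ _ leb)// mule_gt0//.
    suff h : (0 < leb `[1%R, 2%R]%classic)%E by exact: h.
    by rewrite lebesgue_measure_itv/= lte_fin ltr1n -EFinB lte_fin; lra.
  apply: (@le_trans _ _ (\int[leb]_(t in `[1%R, 2%R]) F t)%E); last first.
    apply: ge0_subset_integral => //. move=> t /=; rewrite !in_itv/= andbT => /andP[t1 _].
    by rewrite (lt_le_trans _ t1).
  apply: ge0_le_integral => //.
  move=> t; rewrite /= in_itv/= => /andP[t1 t2].
  have t0 : 0 < t by rewrite (lt_le_trans _ t1).
  rewrite lee_fin ler_pM ?expR_ge0 ?invr_ge0//; last by rewrite ler_expR lerN2.
    apply: (@le_trans _ _ (t `^ (- 1))).
      by rewrite powR_inv1 ?(ltW t0)// lef_pV2 ?posrE.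
    by rewrite ler_powR//; lra.
have -> : `]0, +oo[%classic = `]0, 1]%classic `|` `]1, +oo[%classic :> set R.
  apply/seteqP; split => t /=; rewrite !in_itv/= !andbT.
    by move=> t0; have [t1|t1] := leP t 1; [left|right]; rewrite ?t0.
  by case => [/andP[]//|t1]; exact: (lt_trans _ t1).
have [C C0 FC] := powR_expRN_le a.
rewrite ge0_integral_setU//; [|by move=> t _; exact: F0|]; last first.
  rewrite disj_set2E; apply/eqP/seteqP; split => t //=; rewrite !in_itv/= andbT.
  by move=> [/andP[_ t1] /(le_lt_trans t1)]; rewrite ltxx.
apply: lte_add_pinfty.
  apply: le_lt_trans (@integral_powR_near0 (1 - a) _); last by lra.
  apply: ge0_le_integral => //.
  - by move=> t _; exact: F0.
  - exact: measurable_powR_cst.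
  - move=> t; rewrite /= in_itv/= => /andP[t0 t1]; rewrite lee_fin opprB.
    by rewrite ler_piMr ?powR_ge0// -expR0 ler_expR oppr_le0 ltW.
apply: (@le_lt_trans _ _ (\int[leb]_(t in `[1%R, +oo[) F t)%E).
  apply: (@ge0_subset_integral _ _ _ leb) => //; first by move=> t _; exact: F0.
  by move=> t /=; rewrite !in_itv/= !andbT; exact: ltW.
apply: (@le_lt_trans _ _ (\int[leb]_(t in `[1%R, +oo[) (C%:E * (t `^ (- 2))%:E))%E).
  apply: ge0_le_integral => //.
  - by apply: measurable_funeM; exact: measurable_powR_cst.
  - by move=> t; rewrite /= in_itv/= andbT => t1; rewrite lee_fin FC.
rewrite ge0_integralZl//; last 2 first.
  exact: measurable_powR_cst.
  by move=> t _; rewrite lee_fin powR_ge0.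
rewrite integral_tail_powR ?ltry//; lra.
Qed.

End gamma.

(** * Rational boxes and Schwartz functions *)

Section rational_boxes.
Context {R : realType}.
Local Notation lam n := (@lebesgue_rV R n).

(** In units of 1/(k+1) the boxes have half-widths 1 and 3, which leaves a margin of 2 around the
    small one. Points of the large box are less than 4 units from x, hence the choice 4/(k+1) <
    e. *)
Lemma open_rational_box n (A : set 'rV[R]_n) x : open A -> A x ->
  exists (q : 'rV[rat]_n) (k : nat),
    box (map_mx ratr q) k.+1%:R^-1 x /\ box (map_mx ratr q) (3 / k.+1%:R) `<=` A.
Proof.
move=> oA Ax; have /nbhs_ballP[e /= e0 eA] : nbhs x A by exact: open_nbhs_nbhs.
pose k := Num.truncn (4 / e).
have k0 : 0 < k.+1%:R^-1 :> R by rewrite invr_gt0.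
have ke : 4 * k.+1%:R^-1 < e.
  have e4 : 0 <= 4 / e by rewrite divr_ge0// ltW.
  have /andP[_] := truncn_itv e4.
  by rewrite ltr_pdivrMr// mulrC -ltr_pdivrMr.
have rq i : exists q : rat, `|x 0 i - ratr q| < k.+1%:R^-1.
  have xi : x 0 i - k.+1%:R^-1 < x 0 i + k.+1%:R^-1.
    by rewrite ltrD2l (lt_trans _ k0)// oppr_lt0.
  have [q] := rat_in_itvoo xi; rewrite in_itv/= => qx; exists q.
  by rewrite distrC ltr_distl.
pose q : 'rV[rat]_n := \row_i xchoose (rq i).
have xq i : `|x 0 i - map_mx ratr q 0 i| < k.+1%:R^-1.
  by rewrite !mxE; exact: (xchooseP (rq i)).
exists q, k; split => // y yq; apply: eA; split => // i j.
rewrite !ord1 {i} /ball/=.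
rewrite (_ : x 0 j - y 0 j = (x 0 j - map_mx ratr q 0 j) - (y 0 j - map_mx ratr q 0 j)); last first.
  by rewrite opprB [RHS]addrA subrK.
rewrite (le_lt_trans (ler_normB _ _))// (lt_trans _ ke)//.
have := xq j; have := yq j; move: (k.+1%:R^-1) ke => d ke; lra.
Qed.

(** The sigma-algebra is generated by the coordinates, so an open set is written as a countable
    union of rational boxes. *)
Lemma open_rV_measurable n (A : set 'rV[R]_n) : open A -> measurable A.
Proof.
move=> oA; pose B (p : 'rV[rat]_n * nat) : set 'rV[R]_n :=
  if `[< box (map_mx ratr p.1) p.2.+1%:R^-1 `<=` A >]
  then box (map_mx ratr p.1) p.2.+1%:R^-1 else set0.
rewrite (_ : A = \bigcup_p B p).
  apply: countable_bigcupT_measurable; first exact: countableP.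
  by move=> p; rewrite /B; case: ifP => // _; exact: measurable_box.
apply/seteqP; split => [x Ax|x [p _]]; last first.
  by rewrite /B; case: ifP => // /asboolP; apply.
have [q [k [xq qA]]] := open_rational_box oA Ax; exists (q, k) => //=.
rewrite /B ifT//; apply/asboolP; apply: subset_trans qA => y yq i.
by rewrite (lt_le_trans (yq i))// ler_peMl ?invr_ge0// ler1n.
Qed.

Lemma continuous_rV_measurable n (g : 'rV[R]_n -> R) : continuous g ->
  measurable_fun setT g.
Proof.
move=> /continuousP cg; apply: (measurability _ (RGenOpens.measurableE R)).
move=> _ [_ [a [b ->] <-]]; rewrite setTI; apply: open_rV_measurable.
exact/cg/interval_open.
Qed.

Lemma outer_pos_not_negligible n (E : set 'rV[R]_n) :
  (0 < lebesgue_outer E)%E -> ~ (lam n).-negligible E.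
Proof.
move=> E0 [N [mN N0 EN]]; have := le_mu_ext (lam n) EN.
by move=> /(lt_le_trans E0); rewrite (_ : mu_ext _ N = 0%E) ?ltxx// -N0; exact: measurable_mu_extE.
Qed.

(** The rational boxes of half-width r whose concentric box of half-width 3r lies in U are countably
    many and cover U, so E cannot meet all of them in null sets. The distance 2r is 3r - r. *)
Lemma non_negligible_box n (U E : set 'rV[R]_n) : open U -> E `<=` U ->
  ~ (lam n).-negligible E ->
  exists (V : set 'rV[R]_n) (r : R), [/\ measurable V, 0 < r,
    ~ (lam n).-negligible (E `&` V) &
    forall x y, V x -> enorm (x - y) < 2 * r -> U y].
Proof.
move=> oU EU nE; apply: contrapT => H; apply: nE.
pose P (p : 'rV[rat]_n * nat) := box (map_mx ratr p.1) (3 / p.2.+1%:R) `<=` U.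
pose B (p : 'rV[rat]_n * nat) : set 'rV[R]_n := box (map_mx ratr p.1) p.2.+1%:R^-1.
pose N k := if unpickle k is Some p then E `&` [set x | P p /\ B p x] else set0.
apply: (@negligibleS _ _ _ _ (\bigcup_k N k)).
  move=> x Ex; have [q [k [xq qU]]] := open_rational_box oU (EU _ Ex).
  by exists (pickle (q, k)) => //; rewrite /N pickleK.
apply: negligible_bigcup => k; rewrite /N; case: unpickle => [p|]; last exact: negligible_set0.
have [Pp|nP] := pselect (P p); last first.
  by apply: negligibleS (negligible_set0 _) => x [_ []].
apply: contrapT => nB; apply: H; exists (B p), (p.2.+1%:R^-1); split.
- exact: measurable_box.
- by rewrite invr_gt0.
- by apply: contra_not nB; apply: negligibleS => x [Ex [_ Bx]].
- move=> x y Bx xy; apply: Pp => i.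
  rewrite (_ : y 0 i - _ = (x 0 i - map_mx ratr p.1 0 i) - (x - y) 0 i); last first.
    by rewrite !mxE; ring.
  rewrite (le_lt_trans (ler_normB _ _))//.
  have := Bx i; have := le_lt_trans (coord_le_enorm (x - y) i) xy.
  by move: (p.2.+1%:R^-1) => d; lra.
Qed.

End rational_boxes.

Section schwartz_integrable.
Context {R : realType}.
Local Notation leb := (@lebesgue_measure R).
Local Notation lam n := (@lebesgue_rV R n).

Lemma integral_oneDsqrV : (\int[leb]_t (oneDsqr t)^-1%:E = pi%:E)%E.
Proof.
rewrite ge0_symfun_integralT.
- rewrite -set_itvcy integral0y_oneDsqr -EFinM; congr EFin.
  by rewrite mulrC divfK.
- by move=> t; rewrite invr_ge0 (le_trans _ (oneDsqr_ge1 t)).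
- exact: continuous_oneDsqrV.
- by move=> t; rewrite /= /oneDsqr sqrrN.
Qed.

Lemma measurable_prod_oneDsqrV n :
  measurable_fun setT (fun x : 'rV[R]_n => (\prod_i (oneDsqr (x 0 i))^-1)%:E).
Proof.
apply/measurable_EFinP; apply: measurable_prod => i _.
apply: (@measurableT_comp _ _ _ _ _ _ (fun t : R => (oneDsqr t)^-1)); last exact: measurable_coord.
apply: continuous_measurable_fun; exact: continuous_oneDsqrV.
Qed.

Lemma integral_prod_oneDsqrV n :
  (\int[lam n]_x (\prod_i (oneDsqr (x 0 i))^-1)%:E < +oo)%E.
Proof.
have p0 m (x : 'rV[R]_m) : 0 <= \prod_i (oneDsqr (x 0 i))^-1.
  by apply: prodr_ge0 => i _; rewrite invr_ge0 (le_trans _ (oneDsqr_ge1 _)).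
have mp m := @measurable_prod_oneDsqrV m.
elim: n => [|n IH].
  rewrite (_ : integral _ _ _ = 1%E) ?ltry//.
  apply: etrans (@integral_dirac _ _ (0 : 'rV[R]_0) R setT measurableT _ (mp 0)) _.
  by rewrite big_ord0 diracE in_setT mule1.
rewrite ge0_integral_rVS//; last by move=> y; rewrite lee_fin.
have m1 : measurable_fun setT (fun t : R => (oneDsqr t)^-1%:E).
  by apply/measurable_EFinP; apply: continuous_measurable_fun; exact: continuous_oneDsqrV.
have o0 (t : R) : 0 <= (oneDsqr t)^-1 by rewrite invr_ge0 (le_trans _ (oneDsqr_ge1 t)).
rewrite (eq_integral (fun t : measurableTypeR R => (oneDsqr (t : R))^-1%:E * \int[lam n]_x
  (\prod_i (oneDsqr (x 0 i))^-1)%:E)%E).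
  rewrite ge0_integralZr//; last first.
    by apply: integral_ge0 => x _; rewrite lee_fin.
  rewrite [X in (X * _)%E](_ : _ = pi%:E); last exact: integral_oneDsqrV.
  by rewrite lte_mul_pinfty// ?lee_fin ?pi_ge0.
move=> t _; rewrite -ge0_integralZl//; [|exact: mp|by move=> x _; rewrite lee_fin].
apply: eq_integral => y _; rewrite big_ord_recl EFinM; congr (_ * _)%E.
  by rewrite mxE unlift_none.
by congr EFin; apply: eq_bigr => i _; rewrite mxE liftK.
Qed.

(** The product of the 1 + x_i^2 expands into 2^n monomials, each bounded when multiplied by g; so g
    is dominated by a multiple of the integrable product of the 1/(1 + x_i^2). *)
Lemma schwartz_integrable n (g : 'rV[R]_n -> R) : schwartz g ->
  (lam n).-integrable setT (EFin \o g).
Proof.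
move=> [sg bg]; have [cg _] := sg [::].
have mg := continuous_rV_measurable cg.
have [M gM] : exists M : R, forall x : 'rV[R]_n, `|(\prod_i oneDsqr (x 0 i)) * g x| <= M.
  pose b (f : {ffun 'I_n -> bool}) (i : 'I_n) := (2 * f i)%N.
  have [K KP] := choice (fun f => bg [::] (b f)).
  exists (\sum_f K f) => x.
  have -> : \prod_i oneDsqr (x 0 i) = \sum_f \prod_i x 0 i ^+ b f i.
    rewrite -(bigA_distr_bigA (fun i (c : bool) => x 0 i ^+ (2 * c))).
    by apply: eq_bigr => i _; rewrite big_bool /= muln1 muln0 expr0 addrC.
  rewrite mulr_suml (le_trans (ler_norm_sum _ _ _))//.
  by apply: ler_sum => f _; exact: KP.
have P1 (x : 'rV[R]_n) : 0 < \prod_i oneDsqr (x 0 i).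
  by apply: prodr_gt0 => i _; rewrite (lt_le_trans _ (oneDsqr_ge1 _)).
have iP : (lam n).-integrable setT (fun x => (\prod_i (oneDsqr (x 0 i))^-1)%:E).
  apply/integrableP; split; first exact: measurable_prod_oneDsqrV.
  apply: le_lt_trans (integral_prod_oneDsqrV n); rewrite le_eqVlt; apply/orP; left.
  apply/eqP; apply: eq_integral => x _; rewrite gee0_abs// lee_fin.
  by apply: prodr_ge0 => i _; rewrite invr_ge0 (le_trans _ (oneDsqr_ge1 _)).
apply: (le_integrable measurableT _ _ (integrableZl measurableT M iP)).
  exact/measurable_EFinP.
move=> x _ /=; rewrite lee_fin prodfV normrM (ger0_norm (_ : 0 <= (_)^-1)); last first.
  by rewrite invr_ge0 ltW.
rewrite ler_pdivlMr// mulrC -(ger0_norm (ltW (P1 x))) -normrM.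
by rewrite (le_trans (gM x))// ler_norm.
Qed.

End schwartz_integrable.

(** * The averages *)

(* If the integral of [F] is infinite or undefined, both sides are [0]: [fine]
   maps the infinities to [0]. *)
Lemma Rintegral_scale d (T : measurableType d) (R : realType)
    (mu : {measure set T -> \bar R}) (D : set T) (a : R) (F : T -> R) :
  measurable D -> measurable_fun D F ->
  \int[mu]_(x in D) (a * F x) = a * \int[mu]_(x in D) F x.
Proof.
move=> mD mF; have mF' : measurable_fun D (EFin \o F) by exact/measurable_EFinP.
have mp := measurable_funepos mF'; have mn := measurable_funeneg mF'.
transitivity (fine (\int[mu]_(x in D) (a%:E * (EFin \o F) x)%E)); first by [].
rewrite /Rintegral integralE [in RHS]integralE.
have p0 : (0 <= \int[mu]_(x in D) (EFin \o F)^\+%E x)%E by exact: integral_ge0.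
have q0 : (0 <= \int[mu]_(x in D) (EFin \o F)^\-%E x)%E by exact: integral_ge0.
have [a0|a0] := leP 0 a.
  rewrite ge0_funeposM// ge0_funenegM// !ge0_integralZl//.
  move: (integral _ _ _) (integral _ _ _) p0 q0 => p q.
  have [->|a1] := eqVneq a 0; first by rewrite !mul0e sube0 mul0r.
  have {a0 a1} a0 : 0 < a by rewrite lt_neqAle eq_sym a1.
  case: p => [p| |]//; case: q => [q| |]// _ _; rewrite ?gt0_muley ?lte_fin ?mulr0//=.
  by rewrite mulrBr.
rewrite le0_funeposM ?(ltW a0)// le0_funenegM ?(ltW a0)//.
rewrite -EFinN !ge0_integralZl// ?lee_fin ?oppr_ge0 ?(ltW a0)//.
move: (integral _ _ _) (integral _ _ _) q0 p0 => q p.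
case: p => [p| |]//; case: q => [q| |]// _ _; rewrite ?gt0_muley ?lte_fin ?oppr_gt0 ?mulr0//=.
by ring.
Qed.

Section translation.
Context {R : realType} (n : nat).
Local Notation lam := (@lebesgue_rV R n).
Variables (F : 'rV[R]_n -> R) (a : 'rV[R]_n).

Let shift_ge0 (G : 'rV[R]_n -> \bar R) : measurable_fun setT G ->
  (forall y, 0 <= G y)%E -> (\int[lam]_y G (y + a)%R = \int[lam]_y G y)%E.
Proof.
move=> mG G0; have := ge0_integral_rV_affine a ltr01 mG G0.
rewrite expr1n invr1 mul1e => <-; apply: eq_integral => y _.
by rewrite scale1r.
Qed.

Lemma measurable_shift : measurable_fun [set: 'rV[R]_n] (fun z => z + a).
Proof.
apply: measurable_rVP => i; under eq_fun do rewrite mxE.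
by apply: measurable_funD => //; exact: measurable_coord.
Qed.

Lemma Rintegral_shift : measurable_fun setT F ->
  \int[lam]_z F (z + a) = \int[lam]_z F z.
Proof.
move=> mF; have mF' : measurable_fun setT (EFin \o F) by exact/measurable_EFinP.
rewrite /Rintegral integralE [in RHS]integralE; congr (fine (_ - _)).
- rewrite -[RHS](shift_ge0 (measurable_funepos mF') (fun=> funepos_ge0 _ _)).
  by apply: eq_integral => z _; rewrite !funeposE.
- rewrite -[RHS](shift_ge0 (measurable_funeneg mF') (fun=> funeneg_ge0 _ _)).
  by apply: eq_integral => z _; rewrite !funenegE.
Qed.

Lemma integrable_shift : lam.-integrable setT (EFin \o F) ->
  lam.-integrable setT (EFin \o (fun z => F (z + a))).
Proof.
move=> /integrableP[mF iF]; apply/integrableP; split.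
  by apply: (measurableT_comp mF); exact: measurable_shift.
rewrite (shift_ge0 (G := fun z => `|(EFin \o F) z|%E))//.
by apply: measurableT_comp.
Qed.

End translation.

Section radial_integral.
Context {R : realType} (n : nat).
Local Notation leb := (@lebesgue_measure R).
Local Notation lam := (@lebesgue_rV R n.+1).
Variables (g : 'I_n.+1 -> 'I_n.+1 -> 'rV[R]_n.+1 -> R) (r s : R) (x : 'rV[R]_n.+1).
Hypothesis ig : forall j k, lam.-integrable setT (EFin \o g j k).

Lemma ker_even (l : seq 'I_n.+1) b (y : 'rV[R]_n.+1) : ~~ odd (size l) ->
  ker l b (- y) = ker l b y.
Proof.
move=> ev; rewrite /ker enormN; congr (_ * _).
have -> : mono l (- y) = (-1) ^+ size l * mono l y.
  elim: l {ev} => [|i l IH]; first by rewrite /mono !big_nil mul1r.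
  by rewrite !mono_cons IH mxE exprS; ring.
by rewrite -signr_odd (negbTE ev) expr0 mul1r.
Qed.

(** With y = x + z the kernel is evaluated at -z, which is harmless in even degree. *)
Lemma conv_center (l : seq 'I_n.+1) (b : R) (h : 'rV[R]_n.+1 -> R) :
  lam.-integrable setT (EFin \o h) -> ~~ odd (size l) ->
  conv h r l b x = \int[lam]_z (h (x + z) * (cut r z * ker l b z)).
Proof.
move=> ih ev; have mh : measurable_fun setT h.
  by apply/measurable_EFinP; exact: measurable_int ih.
rewrite /conv -(Rintegral_shift x); last first.
  by apply: measurable_funM => //; exact: measurable_cut_ker.
apply: eq_Rintegral => z _; rewrite [z + x]addrC opprD addNKr /cut enormN.
by rewrite ker_even.
Qed.

Lemma integrable_center (l : seq 'I_n.+1) (b : R) (h : 'rV[R]_n.+1 -> R) :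
  lam.-integrable setT (EFin \o h) -> 0 < r -> (size l)%:R + b <= 0 ->
  lam.-integrable setT (EFin \o (fun z => h (x + z) * (cut r z * ker l b z))).
Proof.
move=> ih r0 lb; apply: (@integrableM_bounded _ _ (fun z => h (x + z)) _ (r `^ ((size l)%:R + b))).
- rewrite (_ : (fun z => h (x + z)) = (fun z => h (z + x))); first exact: integrable_shift.
  by apply/funext => z; rewrite addrC.
- by apply: measurable_funM; [exact: measurable_cut|exact: measurable_ker].
- by move=> z; exact: cut_ker_bound.
Qed.

(** Polar coordinates z = t xi around x. The cut at r is invisible because g vanishes within 2r of
    x, and it makes the integrand zero at the origin, as [polar_coordinates] requires. *)
Lemma surface_radial_integral (l m : 'I_n.+1) : 0 < r ->
  2 * s - n.+1%:R <= 0 ->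
  (forall j k y, enorm (x - y) < 2 * r -> g j k y = 0) ->
  \int[@surface_measure R n.+1]_(xi in @unit_sphere R n.+1)
    (xi 0 l * xi 0 m * \int[leb]_(t in `]0, +oo[)
      (t `^ (2 * s - 1) * \sum_j \sum_k g j k (x + t *: xi) * xi 0 j * xi 0 k)) =
  full_contraction g r [:: l; m] (2 * s - n.+1%:R - 4) x.
Proof.
move=> r0 sn gV; set b := _ - 4.
have mg j k : measurable_fun setT (g j k).
  by apply/measurable_EFinP; exact: measurable_int (ig j k).
have lb j k : (size [:: j; k; l; m])%:R + b <= 0.
  by rewrite /= /b addrC subrK.
pose h j k z := g j k (x + z) * (cut r z * ker [:: j; k; l; m] b z).
have ih j k : lam.-integrable setT (EFin \o h j k) by exact: integrable_center.
have ihj j : lam.-integrable setT (EFin \o (fun z => \sum_k h j k z)).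
  rewrite (_ : _ \o _ = fun z => (\sum_k (h j k z)%:E)%E).
    by apply: integrable_sum => // k _; exact: ih.
  by apply/funext => z /=; rewrite sumEFin.
have ihh : lam.-integrable setT (EFin \o (fun z => \sum_j \sum_k h j k z)).
  rewrite (_ : _ \o _ = fun z => (\sum_j (\sum_k h j k z)%:E)%E).
    by apply: integrable_sum => // j _; exact: ihj.
  by apply/funext => z /=; rewrite sumEFin.
transitivity (\int[lam]_z \sum_j \sum_k h j k z); last first.
  rewrite (@Rintegral_sum _ _ _ lam setT _ _ _ measurableT ihj); apply: eq_bigr => j _.
  rewrite (@Rintegral_sum _ _ _ lam setT _ _ _ measurableT (ih j)); apply: eq_bigr => k _.
  by symmetry; apply: conv_center.
rewrite -polar_coordinates//; last first.
  by rewrite big1// => j _; rewrite big1// => k _; rewrite /h cut0 ?enorm0// mul0r mulr0.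
apply: eq_Rintegral => xi /set_mem xi1.
have ml : measurable_fun setT (fun t : R => x + t *: xi).
  apply: measurable_rVP => i; under eq_fun do rewrite !mxE.
  by apply: measurable_funD => //; exact: measurable_funM.
rewrite -Rintegral_scale//; last first.
  apply: (@measurable_funS _ _ _ _ setT) => //.
  apply: measurable_funM => //.
  apply: measurable_sum => j; apply: measurable_sum => k.
  do 2![apply: measurable_funM => //].
  exact: (measurableT_comp (mg j k) ml).
apply: eq_Rintegral => t /set_mem; rewrite /= in_itv/= andbT => t0.
have et : enorm (t *: xi) = t by rewrite enormZ xi1 mulr1 gtr0_norm.
rewrite mulrCA !mulr_sumr; apply: eq_bigr => j _.
rewrite !mulr_sumr; apply: eq_bigr => k _.
rewrite /h; have [tr|tr] := ler_or_lt r t; last first.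
  rewrite gV ?mul0r ?mulr0//.
  by rewrite opprD addNKr enormN et (lt_trans tr)// ltr_pMl// ltr1n.
rewrite cut1 ?et// /ker et mul1r !mono_cons {1}/mono big_nil !mxE.
(* t^n is the Jacobian in dimension n+1, t^4 comes from the monomial of degree 4, and n + 4 + b = 2s
   - 1. *)
have -> : t `^ (2 * s - 1) = t ^+ n * (t ^+ 4 * t `^ b).
  rewrite -!powR_mulrn ?(ltW t0)// -!powRD ?(gt_eqF t0) ?implybT//.
  by congr (_ `^ _); rewrite /b -natr1; ring.
by ring.
Qed.

End radial_integral.

Section parts.
Context {R : realType}.

(** A Boolean parameter, so that one argument about real functions serves both the real and the
    imaginary part. *)
Definition part (b : bool) (z : R[i]) : R := if b then complex.Re z else complex.Im z.

Lemma partMl b (a : R) (z : R[i]) : part b (a%:C * z) = a * part b z.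
Proof. by case: b z => -[p q] /=; rewrite mul0r ?subr0 ?addr0. Qed.

Lemma partMr b (a : R) (z : R[i]) : part b (z * a%:C) = part b z * a.
Proof. by rewrite mulrC partMl mulrC. Qed.

Lemma part0 b : part b 0 = 0. Proof. by case: b. Qed.

Lemma part_sum b (I : Type) (s : seq I) (F : I -> R[i]) :
  part b (\sum_(i <- s) F i) = \sum_(i <- s) part b (F i).
Proof. by case: b; rewrite /part raddf_sum. Qed.

Lemma part_cintegral b d (T : measurableType d) (mu : {measure set T -> \bar R})
    (D : set T) (F : T -> R[i]) :
  part b (cintegral mu D F) = \int[mu]_(x in D) part b (F x).
Proof. by case: b. Qed.

Lemma c22_neq0 n (s : R) : 0 < s < 1 -> c22 n s != 0.
Proof.
move=> /andP[s0 s1]; rewrite /c22 mulf_neq0 ?oppr_eq0 ?invr_neq0 ?mulf_neq0//.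
all: rewrite ?gt_eqF ?powR_gt0 ?pi_gt0 ?Gamma_gt0//.
by rewrite divr_gt0//; have : 0 <= n%:R :> R by []; lra.
Qed.

Lemma part_average2_eq0 b n (s : R) (f : 'rV[R]_n -> 'M[R[i]]_n) x l m : 0 < s < 1 ->
  average2 s f x l m = 0 ->
  \int[@surface_measure R n]_(xi in @unit_sphere R n)
    (xi 0 l * xi 0 m * \int[@lebesgue_measure R]_(t in `]0, +oo[)
      (t `^ (2 * s - 1) *
       \sum_j \sum_k part b (f (x + t *: xi) j k) * xi 0 j * xi 0 k)) = 0.
Proof.
move=> s01 /(congr1 (part b)); rewrite /average2 partMl.
rewrite part0 => /eqP; rewrite mulf_eq0 (negbTE (c22_neq0 n s01))/= => /eqP h.
rewrite -[RHS]h part_cintegral; apply: eq_Rintegral => xi _.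
rewrite -[in RHS]mulrA !partMl mulrA part_cintegral; congr (_ * _).
apply: eq_Rintegral => t _; rewrite partMl part_sum; congr (_ * _).
apply: eq_bigr => j _; rewrite part_sum; apply: eq_bigr => k _.
by rewrite !partMr.
Qed.

End parts.

Theorem theorem4p15 (R : realType) (n : nat) (hn : (2 <= n)%N)
    (s : R) (hs : 0 < s < 1) (hs2 : s != 1 / 2)
    (f : 'rV[R]_n -> 'M[R[i]]_n) (hf : schwartz_sym2 f)
    (U : set 'rV[R]_n) (Uopen : open U) (U0 : U !=set0)
    (fU : forall x, U x -> f x = 0)
    (hE : exists E : set 'rV[R]_n,
      [/\ E `<=` U,
          lebesgue_measurable E,
          (0 < lebesgue_outer E)%E &
          forall x, E x ->
            [/\ average0 s f x = 0,
                (forall i, average1 s f x i = 0) &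
                forall i1 i2, average2 s f x i1 i2 = 0]]) :
  forall x, f x = 0.
Proof.
case: n hn f hf U Uopen U0 fU hE => [//|n] hn f [fT fS] U Uopen _ fU [E [EU _ E0 avE]].
have [V [r [mV r0 nEV VU]]] := non_negligible_box Uopen EU (outer_pos_not_negligible E0).
have /andP[s0 s1] := hs.
have n1 : 1 <= n%:R :> R by rewrite ler1n.
have sn : 2 * s - n.+1%:R <= 0 by rewrite -natr1; lra.
suff H b j k x : part b (f x j k) = 0.
  move=> x; apply/matrixP => j k; rewrite mxE; apply/eqP.
  rewrite eq_complex; apply/andP.
  by split; apply/eqP; [exact: (H true)|exact: (H false)].
have gS j' k' : schwartz (fun y => part b (f y j' k')).
  by have [] := fS j' k'; case: b.
have gV j' k' x' y : V x' -> enorm (x' - y) < 2 * r -> part b (f y j' k') = 0.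
  by move=> Vx xy; rewrite (fU _ (VU _ _ Vx xy)) mxE part0.
(* In dimension N = n+1 the exponent is c = 2s - N - 2. Then c + 2 = 2s - N <= 0 since N >= 2, c + N
   = 2s - 2 < 0, and c + N + 1 = 2s - 1 is nonzero. *)
apply: (@tensor_unique_continuation R n.+1 V (E `&` V) mV _ nEV
  (fun j k y => part b (f y j k)) r _ r0 _ _ gV (2 * s - n.+1%:R - 2)).
- exact: subIsetr.
- by move=> j' k'; apply/funext => y; rewrite -[in LHS]fT mxE.
- by move=> j' k'; exact: schwartz_integrable.
- by move=> j' k'; have [/(_ [::])[]] := gS j' k'.
- by rewrite subrK.
- by rewrite addrAC subrK; lra.
- rewrite [X in X != 0](_ : _ = 2 * (s - 1 / 2)); last by field.
  by rewrite mulf_neq0// subr_eq0.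
- move=> l m; apply: (eq_vanishes _ (vanishes0 _)) => x' [Ex Vx].
  have [_ _ av2] := avE _ Ex.
  rewrite -[LHS](part_average2_eq0 b hs (av2 l m)).
  have -> : 2 * s - n.+1%:R - 2 - 2 = 2 * s - n.+1%:R - 4 by ring.
  apply: (@surface_radial_integral R n (fun j k y => part b (f y j k))) => //.
  + by move=> j' k'; exact: schwartz_integrable.
  + by move=> j' k' y; exact: gV.
Qed.
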